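(* Let $U$ be a bounded compact domain in $\mathbb{R}^2$ and let $\boldsymbol{X}:U\to\mathbb{R}^4_1$ be a marginally trapped surface, that is, $\boldsymbol{X}$ is a spacelike embedding satisfying $H_\ell(\boldsymbol{n}^T,\boldsymbol{n}^S)=0$ (resp. $H_\ell(\boldsymbol{n}^T,-\boldsymbol{n}^S)=0$). If $\boldsymbol{X}^\varepsilon$ is a smooth variation of $\boldsymbol{X}$ whose variation vector field is given by $$V^+=\left.\frac{\partial}{\partial\varepsilon}\right|_{\varepsilon=0}\boldsymbol{X}^\varepsilon=\alpha\,\boldsymbol{\ell}^+\qquad\left(\text{resp. } V^-=\left.\frac{\partial}{\partial\varepsilon}\right|_{\varepsilon=0}\boldsymbol{X}^\varepsilon=\alpha\,\boldsymbol{\ell}^-\right),$$ where $\alpha$ is a smooth function on $U$, then the second variation of area satisfies $$\left.\frac{d^2}{d\varepsilon^2}\right|_{\varepsilon=0}A(\boldsymbol{X}^\varepsilon)=2\int_U\alpha^2K_\ell(\boldsymbol{n}^T,\boldsymbol{n}^S)\,dM\qquad\left(\text{resp. }\left.\frac{d^2}{d\varepsilon^2}\right|_{\varepsilon=0}A(\boldsymbol{X}^\varepsilon)=2\int_U\alpha^2K_\ell(\boldsymbol{n}^T,-\boldsymbol{n}^S)\,dM\right).$$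
   Context: $\mathbb{R}^4_1$ is $\mathbb{R}^4$ with the pseudo scalar product $\langle \boldsymbol{x},\boldsymbol{y}\rangle_1=-x_0y_0+x_1y_1+x_2y_2+x_3y_3$. A smooth embedding $\boldsymbol{X}:U\to\mathbb{R}^4_1$ is spacelike if the induced metric $g_{ij}=\langle\boldsymbol{X}_{u_i},\boldsymbol{X}_{u_j}\rangle_1$ is positive definite. $\{\boldsymbol{n}^S,\boldsymbol{n}^T\}$ is a smooth orthonormal frame of the normal bundle of $\boldsymbol{X}$ with $\boldsymbol{n}^S$ spacelike ($\langle\boldsymbol{n}^S,\boldsymbol{n}^S\rangle_1=1$), $\boldsymbol{n}^T$ timelike ($\langle\boldsymbol{n}^T,\boldsymbol{n}^T\rangle_1=-1$) and $\langle\boldsymbol{n}^T,\boldsymbol{n}^S\rangle_1=0$; set $\boldsymbol{\ell}^\pm=\boldsymbol{n}^T\pm\boldsymbol{n}^S$, which are lightlike normal fields. With $\pi^t$ the orthogonal projection of $T_p\mathbb{R}^4_1$ onto the tangent plane, let $S_p(\boldsymbol{n}^T,\pm\boldsymbol{n}^S)=-\pi^t\circ d_p(\boldsymbol{n}^T\pm\boldsymbol{n}^S)$; then $H_\ell(\boldsymbol{n}^T,\pm\boldsymbol{n}^S)=\frac12\mathrm{Trace}\,S_p(\boldsymbol{n}^T,\pm\boldsymbol{n}^S)$ (lightcone mean curvature) and $K_\ell(\boldsymbol{n}^T,\pm\boldsymbol{n}^S)=\det S_p(\boldsymbol{n}^T,\pm\boldsymbol{n}^S)$ (lightcone Gauss-Kronecker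 curvature). The area is $A(\boldsymbol{X})=\int_U dM$, $dM=\sqrt{g_{11}g_{22}-g_{12}^2}\,du_1du_2$. A smooth variation $\boldsymbol{X}^\varepsilon$ of $\boldsymbol{X}$ is a family, smooth in the parameter $\varepsilon$ (near $0$) and in $u$, such that each $\boldsymbol{X}^\varepsilon:U\to\mathbb{R}^4_1$ is a smooth spacelike surface and $\boldsymbol{X}^0=\boldsymbol{X}$.
   Formalization: The formal theorem adds that the second ε-derivative of X^ε at ε=0 is pointwise a multiple of ℓ^+ (resp. ℓ^-); without it the claim fails, e.g. for the flat disc with X^ε=(0,(1+ε²)u₁,(1+ε²)u₂,0) and α=0, where A''(0)=4π but the right side is 0. *)

(* Defs.v *)
From HB Require Import structures.
From mathcomp Require Import all_boot all_order all_algebra.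
From mathcomp Require Import all_classical all_reals all_analysis.

Set Implicit Arguments.
Unset Strict Implicit.
Unset Printing Implicit Defensive.

Import Order.TTheory GRing.Theory Num.Theory.
Import numFieldNormedType.Exports.

Local Open Scope classical_set_scope.
Local Open Scope ring_scope.

Definition iter_derive (R : realType) (V W : normedModType R)
    (f : V -> W) (vs : seq V) : V -> W :=
  foldr (fun v g => fun x => 'D_v g x) f vs.

(* On an open subset of a finite-dimensional space this is C^oo: all iterated
   directional derivatives exist and are continuous. *)
Definition smooth_on (R : realType) (V W : normedModType R)
    (O : set V) (f : V -> W) : Prop :=
  forall (vs : seq V) (x : V), O x ->
    {for x, continuous (iter_derive f vs)} /\
    (forall v : V, derivable (iter_derive f vs) x v).

(* Smooth up to the boundary of a closed set: [f] is (the restriction of) a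
   smooth map on an open neighbourhood. *)
Definition smooth_near (R : realType) (V W : normedModType R)
    (U : set V) (f : V -> W) : Prop :=
  exists O : set V, [/\ open O, U `<=` O & smooth_on O f].

(* Compact sets of the plane are bounded. A domain is a nonempty connected open
   set and a compact domain is the closure of one; in particular, the values on
   [U] of a smooth map determine its derivatives at the boundary points. *)
Definition compact_domain (R : realType) (U : set (R * R)) : Prop :=
  [/\ compact U, U° !=set0, connected U° & U = closure U°].

Definition mink (R : realType) (x y : 'rV[R]_4) : R :=
  - (x 0 0 * y 0 0) + \sum_(i < 4 | i != 0) x 0 i * y 0 i.

Definition coord_dir (R : realType) (i : 'I_2) : R * R :=
  if i == 0 then (1, 0) else (0, 1).

Definition partial (R : realType) (W : normedModType R)
    (i : 'I_2) (f : R * R -> W) (u : R * R) : W :=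
  'D_(coord_dir R i) f u.

Definition first_form (R : realType) (X : R * R -> 'rV[R]_4) (u : R * R) :
    'M[R]_2 :=
  \matrix_(i, j) mink (partial i X u) (partial j X u).

Definition pos_def (R : realType) (g : 'M[R]_2) : Prop :=
  forall w : 'rV[R]_2, w != 0 -> 0 < (w *m g *m w^T) 0 0.

(* [U] is meant to be compact, so that an injective immersion is
   automatically a homeomorphism onto its image. *)
Definition embedding (R : realType) (U : set (R * R))
    (X : R * R -> 'rV[R]_4) : Prop :=
  [/\ smooth_near U X, {in U &, injective X} &
      forall u, U u -> forall v : R * R, 'D_v X u = 0 -> v = 0].

Definition spacelike_embedding (R : realType) (U : set (R * R))
    (X : R * R -> 'rV[R]_4) : Prop :=
  embedding U X /\ (forall u, U u -> pos_def (first_form X u)).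

Definition normal_frame (R : realType) (U : set (R * R))
    (X nT nS : R * R -> 'rV[R]_4) : Prop :=
  [/\ smooth_near U nT, smooth_near U nS &
      forall u, U u ->
        [/\ mink (nS u) (nS u) = 1, mink (nT u) (nT u) = -1,
            mink (nT u) (nS u) = 0 &
            forall i, mink (nT u) (partial i X u) = 0 /\
                      mink (nS u) (partial i X u) = 0]].

(* Coordinates, in the basis X_{u_1}, X_{u_2}, of the orthogonal projection of
   [x] onto the tangent plane: the j-th one is sum_i <x, X_{u_i}> g^{ij}. *)
Definition tangent_coord (R : realType) (X : R * R -> 'rV[R]_4) (u : R * R)
    (x : 'rV[R]_4) : 'rV[R]_2 :=
  (\row_i mink x (partial i X u)) *m invmx (first_form X u).

Definition tangent_proj (R : realType) (X : R * R -> 'rV[R]_4) (u : R * R)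
    (x : 'rV[R]_4) : 'rV[R]_4 :=
  \sum_(j < 2) tangent_coord X u x 0 j *: partial j X u.

(* The value at the tangent vector dX(v) of minus the tangential part of the
   differential of [n]. *)
Definition shape (R : realType) (X n : R * R -> 'rV[R]_4) (u v : R * R) :
    'rV[R]_4 :=
  - tangent_proj X u ('D_v n u).

(* Matrix of the shape operator in the basis X_{u_1}, X_{u_2}; the i-th row
   holds the coordinates of the image of X_{u_i}. *)
Definition shape_mx (R : realType) (X n : R * R -> 'rV[R]_4) (u : R * R) :
    'M[R]_2 :=
  \matrix_(i < 2) tangent_coord X u (shape X n u (coord_dir R i)).

Definition lightcone_mean_curvature (R : realType)
    (X nT nS : R * R -> 'rV[R]_4) (u : R * R) : R :=
  2^-1 * \tr (shape_mx X (fun u' => nT u' + nS u') u).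

Definition lightcone_GK_curvature (R : realType)
    (X nT nS : R * R -> 'rV[R]_4) (u : R * R) : R :=
  \det (shape_mx X (fun u' => nT u' + nS u') u).

Definition area_density (R : realType) (X : R * R -> 'rV[R]_4) (u : R * R) : R :=
  let g := first_form X u in
  Num.sqrt (g 0 0 * g 1 1 - g 0 1 ^+ 2).

Definition surface_integral (R : realType) (U : set (R * R))
    (X : R * R -> 'rV[R]_4) (f : R * R -> R) : R :=
  Rintegral (lebesgue_measure \x lebesgue_measure)%E U
    (fun u => f u * area_density X u).

Definition area (R : realType) (U : set (R * R)) (X : R * R -> 'rV[R]_4) : R :=
  surface_integral U X (fun=> 1).

Definition smooth_variation (R : realType) (U : set (R * R))
    (X : R * R -> 'rV[R]_4) (Xe : R -> R * R -> 'rV[R]_4) : Prop :=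
  exists d : R,
    [/\ 0 < d,
        exists O : set (R * R),
          [/\ open O, U `<=` O &
              smooth_on ([set e : R | `|e| < d] `*` O)
                (fun p : R * (R * R) => Xe p.1 p.2)],
        forall e : R, `|e| < d -> spacelike_embedding U (Xe e) &
        forall u, U u -> Xe 0 u = X u].

Definition has_second_derivative_at0 (R : realType) (F : R -> R) (l : R) :
    Prop :=
  (\forall e \near (0 : R), derivable F e 1) /\ is_derive (0 : R) 1 (derive1 F) l.

(* The variation is directed by [n] to second order: the acceleration at time 0
   is, at each point, a multiple of [n], as for X + e alpha n. The velocity does
   not determine the second variation of area otherwise: an acceleration W
   contributes the first variation of area in the direction of W, which does not
   vanish for a general W, even on a flat disc (for W tangent, nonzero on the
   boundary). *)
Definition acceleration_along (R : realType) (U : set (R * R))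
    (Xe : R -> R * R -> 'rV[R]_4) (n : R * R -> 'rV[R]_4) : Prop :=
  forall u, U u -> exists b : R, derive1n 2 (fun e => Xe e u) 0 = b *: n u.

(* Main.v *)
Require Import Defs.
From HB Require Import structures.
From mathcomp Require Import all_boot all_order all_algebra.
From mathcomp Require Import all_classical all_reals all_analysis.
From mathcomp Require Import ring lra.

Set Implicit Arguments.
Unset Strict Implicit.
Unset Printing Implicit Defensive.

Import Order.TTheory GRing.Theory Num.Theory.
Import numFieldNormedType.Exports.

Local Open Scope classical_set_scope.
Local Open Scope ring_scope.

(** Let [l] be the lightlike normal [nT + nS], [h i j] the product of [l] with
    the second derivatives [X_ij], [g] the metric of [X], and [S] the shape
    matrix, so that [h = S g] and mean curvature zero says that [S] is trace
    free.  The area density is the square root of the Gram determinant [q] of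
    the metric of the varied surface, and the theorem follows from two
    pointwise identities at time zero: [q' = 0] and [q'' = 4 alpha ^ 2 K q],
    which give [2 alpha ^ 2 K (sqrt q)] for the second derivative of [sqrt q].

    Mixed derivatives commute, so the time derivatives of the metric are
    products of space derivatives of the velocity [alpha l] and of the
    acceleration [b l].  As [l] is null and normal, these products collapse:
    the metric has first derivative [- 2 alpha h] and second derivative
    [- 2 b h + 2 alpha ^ 2 m], where [m i j] is the product of [l_i] and [l_j]
    ([mink_partial_velocity], [mink_partial_acceleration]).  Since [l_i] is
    orthogonal to [l], its normal part is a multiple of [l], and
    [m = S h = S ^ 2 g] ([mink_orthogonal_lightlike]); by Cayley-Hamilton this
    is [- K g].  The terms linear in [h] contribute multiples of the trace of
    [S], and what remains of [q''] is [- 4 alpha ^ 2 K q] from [m] plus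
    [8 alpha ^ 2 det h = 8 alpha ^ 2 K q] ([metric_det_variation]).

    The velocity, the acceleration and the frame are only prescribed on the
    compact domain.  Their derivatives there are nevertheless determined, the
    domain being the closure of its interior ([derive_eq_on_closure]).
    Differentiation under the integral sign ([is_derive_integral_compact]) is
    justified by continuity in time and space on a compact set.

    Smoothness is given by iterated directional derivatives.  It is used through
    the class [Ck] of real functions, in which sums, products, inverses and
    square roots are handled by induction on the order; vector fields are
    treated by coordinates.  The case of [nT - nS] is the case of [nT + nS] for
    the frame with [nS] reversed. *)

(** * Measurability in the plane and differentiation under the integral *)

(** Half-open squares of side [1 / (n + 1)] with a corner at a lattice point,
    for the index [(n, i, j)]; for each [n] they tile the plane. *)
Definition grid_square (R : realType) (k : nat * int * int) : set (R * R) :=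
  let cell (i : int) := [set x : R | i%:~R <= x * k.1.1.+1%:R < (i + 1)%:~R] in
  cell k.1.2 `*` cell k.2.

Lemma measurable_grid_square (R : realType) (k : nat * int * int) :
  measurable (grid_square k : set (measurableTypeR R * measurableTypeR R)).
Proof.
have mc (i : int) :
    measurable [set x : measurableTypeR R |
                  i%:~R <= x * k.1.1.+1%:R < (i + 1)%:~R].
  have -> : [set x : measurableTypeR R |
      i%:~R <= x * k.1.1.+1%:R < (i + 1)%:~R] =
      `[i%:~R / k.1.1.+1%:R, (i + 1)%:~R / k.1.1.+1%:R[%classic.
    apply/seteqP; split => x /=; rewrite in_itv /= ler_pdivrMr// ltr_pdivlMr//.
  exact: measurable_itv.
exact: measurableX (mc _) (mc _).
Qed.

Lemma grid_cell_diam (R : realType) (n : nat) (i : int) (x y e : R) :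
  n.+1%:R^-1 < e -> i%:~R <= x * n.+1%:R < (i + 1)%:~R ->
  i%:~R <= y * n.+1%:R < (i + 1)%:~R -> ball x e y.
Proof.
move=> ne; rewrite intrD => /andP[x1 x2] /andP[y1 y2].
rewrite /ball /= /ball_; apply: lt_trans ne.
rewrite -[ltRHS]mul1r ltr_pdivlMr//.
by rewrite -(@gtr0_norm _ n.+1%:R)// -normrM mulrBl ltr_norml; lra.
Qed.

(** An open set of the plane is the countable union of the half-open grid
    squares that it contains, whence it is measurable for the product of the
    two Borel structures. *)
Lemma open_measurable_plane (R : realType) (A : set (R * R)) :
  open A -> measurable (A : set (measurableTypeR R * measurableTypeR R)).
Proof.
move=> oA.
pose F k := if `[< grid_square k `<=` A >] then @grid_square R k else set0.
suff -> : A = \bigcup_(k in [set: nat * int * int]) F k.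
  apply: countable_bigcupT_measurable => [|k]; first exact: countableP.
  rewrite /F; case: ifP => _; last exact: measurable0.
  exact: measurable_grid_square.
apply/seteqP; split => [x Ax|x [k _]]; last first.
  by rewrite /F; case: ifPn => // /asboolP kA /kA.
have /nbhs_ballP[e /= e0 eA] : nbhs x A by exact: open_nbhs_nbhs.
have [n ne] : exists n, n.+1%:R^-1 < e.
  have [n _ /(_ n (leqnn n)) ?] := near_infty_natSinv_lt (PosNum e0).
  by exists n.
have fl (t : R) : (Num.floor (t * n.+1%:R))%:~R <= t * n.+1%:R <
    (Num.floor (t * n.+1%:R) + 1)%:~R by exact: floor_itv.
pose k := (n, Num.floor (x.1 * n.+1%:R), Num.floor (x.2 * n.+1%:R)).
exists k => //; rewrite /F ifT; first by split; exact: fl.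
apply/asboolP => y [y1 y2]; apply: eA.
by split; [apply: grid_cell_diam ne (fl _) y1 | apply: grid_cell_diam ne (fl _) y2].
Qed.

Lemma compact_measurable_plane (R : realType) (A : set (R * R)) :
  compact A -> measurable (A : set (measurableTypeR R * measurableTypeR R)).
Proof.
move=> cA; rewrite -(setCK A); apply: measurableC.
apply: open_measurable_plane; apply: closed_openC.
by apply: compact_closed cA; exact: norm_hausdorff.
Qed.

Lemma compact_finite_area (R : realType) (A : set (R * R)) :
  compact A -> ((lebesgue_measure \x lebesgue_measure) A < +oo)%E.
Proof.
move=> cA; have [M [Mr MA]] := compact_bounded cA.
pose N := M + 1; have {}MA : forall x, A x -> `|x| <= N.
  by move=> x Ax; apply: (MA N) => //; rewrite /N; lra.
have sub : A `<=` (`[-N, N] `*` `[-N, N])%classic.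
  move=> x /MA; rewrite prod_normE ge_max /= => /andP[x1 x2].
  by split; rewrite /= in_itv /= -ler_norml.
apply: (@le_lt_trans _ _ ((lebesgue_measure \x lebesgue_measure)%E
    (`[-N, N] `*` `[-N, N] : set (measurableTypeR R * measurableTypeR R)))).
  apply: le_measure => //; rewrite inE; first exact: compact_measurable_plane.
  by apply: measurableX; exact: measurable_itv.
rewrite product_measure1E; [|exact: measurable_itv..].
have fin : (@lebesgue_measure R `[(- N)%R, N]%classic < +oo)%E.
  by rewrite lebesgue_measure_itv; case: ifP => _ //; rewrite /= -EFinD ltry.
by apply: lte_mul_pinfty => //; rewrite ge0_fin_numE.
Qed.

(** As [f] is continuous, inside the whole plane, at each point of [A], the
    preimage of an open set has the same trace on [A] as its interior. *)
Lemma continuous_measurable_plane (R : realType) (A : set (R * R))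
    (f : R * R -> R) :
  compact A -> (forall x, A x -> {for x, continuous f}) ->
  measurable_fun (A : set (measurableTypeR R * measurableTypeR R))
    (f : _ -> measurableTypeR R).
Proof.
move=> cA cf; apply: (measurability _ (measurable_realfun.RGenOpens.measurableE R)).
move=> _ [_ [a [b ->] <-]].
have -> : A `&` f @^-1` `]a, b[%classic =
          A `&` (f @^-1` `]a, b[%classic)°.
  apply/seteqP; split => x [Ax fx]; split=> //; last exact: interior_subset fx.
  apply: (cf x Ax); apply: open_nbhs_nbhs; split => //.
apply: measurableI; first exact: compact_measurable_plane.
by apply: open_measurable_plane; exact: open_interior.
Qed.

Lemma continuous_pair (R : numFieldType) (V W : normedModType R) (t : V)
    (u : W) : {for u, continuous (pair t)}.
Proof.
apply: (@cvg_pair _ _ _ (nbhs u) (nbhs t) (nbhs u) _ _ _ (fun=> t) id).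
  exact: cvg_cst.
exact: cvg_id.
Qed.

Lemma continuous_compact_bound (R : realType) (T : topologicalType) (K : set T)
    (f : T -> R) :
  compact K -> (forall x, K x -> {for x, continuous f}) ->
  exists2 M, 0 <= M & forall x, K x -> `|f x| <= M.
Proof.
move=> cK cf.
have cfK : compact (f @` K).
  apply: continuous_compact => //; apply: continuous_in_subspaceT => x.
  by rewrite inE; exact: cf.
have [M [Mr MK]] := compact_bounded cfK.
exists (`|M| + 1) => [|x Kx]; first by rewrite addr_ge0.
apply: (MK (`|M| + 1)); last by exists x.
by rewrite (le_lt_trans (ler_norm M))// ltrDl.
Qed.

Lemma continuous_integrable_plane (R : realType) (A : set (R * R))
    (f : R * R -> R) :
  compact A -> (forall x, A x -> {for x, continuous f}) ->
  (lebesgue_measure \x lebesgue_measure)%E.-integrable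
    (A : set (measurableTypeR R * measurableTypeR R)) (EFin \o f).
Proof.
move=> cA cf; apply: measurable_bounded_integrable.
- exact: compact_measurable_plane.
- exact: compact_finite_area.
- exact: continuous_measurable_plane.
- have [M M0 MA] := continuous_compact_bound cA cf.
  exists M; split=> [|N MN x Ax]; first exact: num_real.
  exact: le_trans (MA _ Ax) (ltW MN).
Qed.

(** A continuous time derivative is bounded on the product of the compact set
    with a slightly smaller closed time interval, so a constant dominates the
    difference quotients. *)
Lemma is_derive_integral_compact (R : realType) (U : set (R * R)) (d : R)
    (f f' : R * (R * R) -> R) :
  compact U ->
  (forall (e : R) u, `|e| < d -> U u ->
     [/\ {for (e, u), continuous f}, {for (e, u), continuous f'} &
         is_derive e 1 (fun e => f (e, u)) (f' (e, u))]) ->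
  forall e : R, `|e| < d ->
    is_derive e 1
      (fun e => Rintegral (lebesgue_measure \x lebesgue_measure)%E U
                  (fun u => f (e, u)))
      (Rintegral (lebesgue_measure \x lebesgue_measure)%E U
         (fun u => f' (e, u))).
Proof.
move=> cU Hf e ed.
have slice (g : R * (R * R) -> R) t u : {for (t, u), continuous g} ->
    {for u, continuous (fun u => g (t, u))}.
  move=> cg; apply: (@continuous_comp _ _ _ (pair t) g) => //.
  exact: continuous_pair.
have [r er rd] : exists2 r, `|e| < r & r < d.
  by exists ((`|e| + d) / 2); lra.
have cK : compact (`[- r, r]%classic `*` U).
  by apply: compact_setX => //; exact: segment_compact.
have rlt t : `[- r, r]%classic t -> `|t| < d.
  by rewrite /= in_itv /= -ler_norml => tr; rewrite (le_lt_trans tr).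
have [M M0 MK] : exists2 M, 0 <= M &
    forall p, (`[- r, r]%classic `*` U) p -> `|f' p| <= M.
  apply: continuous_compact_bound => // -[t u] [/= /rlt td Uu].
  by have [] := Hf t u td Uu.
have itvlt t : `]- r, r[%classic t -> `|t| < d.
  by rewrite /= in_itv /= -ltr_norml => tr; rewrite (lt_trans tr).
have Ie : `]- r, r[%classic e by rewrite /= in_itv /= -ltr_norml.
have mU := compact_measurable_plane cU.
have D1 t u : `|t| < d -> U u ->
    partial1of2 (fun t u => f (t, u)) t u = f' (t, u).
  by move=> td Uu; rewrite partial1of2E; have [_ _ [_ ->]] := Hf t u td Uu.
pose mu := (@lebesgue_measure R \x @lebesgue_measure R)%E.
have cvg : h^-1 *: (Rintegral mu U (fun u => f (h *: 1 + e, u)) -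
      Rintegral mu U (fun u => f (e, u))) @[h --> 0^'] -->
    Rintegral mu U (fun u => f' (e, u)).
  under eq_fun do rewrite scaler1.
  have -> : Rintegral mu U (fun u => f' (e, u)) =
      Rintegral mu U (partial1of2 (fun t u => f (t, u)) e).
    by apply: eq_Rintegral => u; rewrite inE => Uu; symmetry; exact: D1.
  apply: (@cvg_differentiation_under_integral R _ _ mu
    (fun t u => f (t, u)) U mU e (- r) r Ie _ _ (cst M)) => //.
  - move=> t /itvlt td; apply: continuous_integrable_plane => // u Uu.
    by apply: slice; have [] := Hf t u td Uu.
  - by move=> t u /itvlt td Uu; have [_ _ []] := Hf t u td Uu.
  - by apply: continuous_integrable_plane => // u _; exact: cvg_cst.
  - move=> t u It Uu; have -> := D1 _ _ (itvlt _ It) Uu.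
    by apply: MK; split => //; apply: subset_itv_oo_cc It.
by apply: DeriveDef; [apply/cvg_ex; eexists; exact: cvg | exact: cvg_lim].
Qed.

(** * Functions of class C^k along directions *)

(** Reduction of a directional derivative to a derivative on the real line,
    where the mean value theorem and the chain rule are available. *)
Lemma is_derive_line (R : numFieldType) (V W : normedModType R) (f : V -> W)
    (x v : V) (t : R) (l : W) :
  is_derive (t *: v + x) v f l <-> is_derive t 1 (fun h => f (h *: v + x)) l.
Proof.
have E : (fun h : R => h^-1 *: (((fun h => f (h *: v + x)) \o shift t) (h *: 1)
      - f (t *: v + x))) =
    (fun h => h^-1 *: ((f \o shift (t *: v + x)) (h *: v) - f (t *: v + x))).
  by apply/funext => h /=; rewrite scalerDl [h%:A]mulr1 addrA.
by split=> -[df dl]; split; rewrite /derivable /derive ?E // -E.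
Qed.

Lemma is_derive_sqrt (R : realType) (V : normedModType R) (f : V -> R)
    (x v : V) (l : R) :
  0 < f x -> is_derive x v f l ->
  is_derive x v (fun y => Num.sqrt (f y)) (l * (2 * Num.sqrt (f x))^-1).
Proof.
move=> fx; rewrite -{1 2}[x]add0r -[in X in X + x](scale0r v) !is_derive_line.
move=> df; rewrite mulrC.
apply: (@is_derive1_comp _ Num.sqrt (fun h => f (h *: v + x))) => //.
by rewrite scale0r add0r; exact: is_derive1_sqrt.
Qed.

(** Directional form of continuous differentiability for real functions, in a
    recursive form for which closure under the algebraic operations is a plain
    induction. *)
Fixpoint Ck (R : realType) (V : normedModType R) (n : nat) (O : set V)
    (f : V -> R) : Prop :=
  (forall x, O x -> {for x, continuous f}) /\
  if n is m.+1 then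
    forall v, (forall x, O x -> derivable f x v) /\ Ck m O ('D_v f)
  else True.

Section Ck_theory.
Variables (R : realType) (V : normedModType R).
Implicit Types (O : set V) (f g : V -> R) (n : nat).

Lemma Ck_continuous n O f : Ck n O f -> forall x, O x -> {for x, continuous f}.
Proof. by case: n => [|n] []. Qed.

Lemma Ck_derivable n O f v : Ck n.+1 O f -> forall x, O x -> derivable f x v.
Proof. by case=> _ /(_ v)[]. Qed.

Lemma Ck_is_derive n O f v : Ck n.+1 O f ->
  forall x, O x -> is_derive x v f ('D_v f x).
Proof. by move=> cf x Ox; apply: derivableP; exact: (@Ck_derivable n O). Qed.

Arguments Ck_continuous [n O f] _ [x] _.
Arguments Ck_derivable [n O f] v _ [x] _.

Lemma Ck_derive n O f v : Ck n.+1 O f -> Ck n O ('D_v f).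
Proof. by case=> _ /(_ v)[]. Qed.

Lemma CkS n O f : Ck n.+1 O f -> Ck n O f.
Proof.
elim: n f => [|n IH] f [cf df]; first by [].
by split=> // v; have [? ?] := df v; split=> //; exact: IH.
Qed.

Lemma Ck_subset n O O' f : O' `<=` O -> Ck n O f -> Ck n O' f.
Proof.
move=> sO; elim: n f => [|n IH] f [cf df].
  by split=> // x /sO; exact: cf.
split=> [x /sO|v]; first exact: cf.
by have [dv cv] := df v; split=> [x /sO|]; [exact: dv | exact: IH].
Qed.

Lemma eq_Ck n O f g : open O -> (forall x, O x -> f x = g x) ->
  Ck n O f -> Ck n O g.
Proof.
move=> oO; elim: n f g => [|n IH] f g fg [cf df].
  split=> // x Ox; have nO : \near x, O x by exact: open_nbhs_nbhs.
  suff : g y @[y --> x] --> g x by [].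
  rewrite -(fg _ Ox); apply: cvg_trans (cf x Ox).
  by apply: near_eq_cvg; near=> y; apply: fg; near: y.
have nfg x : O x -> \forall y \near x, f y = g y.
  move=> Ox; have nO : \near x, O x by exact: open_nbhs_nbhs.
  by near=> y; apply: fg; near: y.
split=> [x Ox|v].
  suff : g y @[y --> x] --> g x by [].
  rewrite -(fg _ Ox); apply: cvg_trans (cf x Ox).
  by apply: near_eq_cvg; exact: nfg.
have [dv cv] := df v; split=> [x Ox|].
  by apply: near_eq_derivable (dv x Ox); exact: nfg.
by apply: IH cv => x Ox; apply: near_eq_derive; exact: nfg.
Unshelve. all: by end_near. Qed.

Lemma Ck_cst n O c : Ck n O (fun=> c).
Proof.
have cc x : O x -> {for x, continuous (fun=> c : R)} by move=> _; exact: cvg_cst.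
elim: n c cc => [|n IH] c cc //; split=> // v; split=> [x _|].
  exact: derivable_cst.
have -> : 'D_v (fun=> c) = fun=> 0 by apply/funext => x; exact: derive_cst.
by apply: IH => x _; exact: cvg_cst.
Qed.

Lemma CkD n O f g : open O -> Ck n O f -> Ck n O g ->
  Ck n O (fun x => f x + g x).
Proof.
move=> oO; elim: n f g => [|n IH] f g Cf Cg.
  by split=> // x Ox; apply: cvgD; apply: Ck_continuous Ox; eassumption.
split=> [x Ox|v].
  by apply: cvgD; apply: Ck_continuous Ox; eassumption.
have df x (Ox : O x) : derivable f x v := Ck_derivable v Cf Ox.
have dg x (Ox : O x) : derivable g x v := Ck_derivable v Cg Ox.
split=> [x Ox|]; first by apply: derivableD; [exact: df | exact: dg].
apply: eq_Ck (IH _ _ (Ck_derive v Cf) (Ck_derive v Cg)) => // x Ox.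
by symmetry; apply: deriveD; [exact: df | exact: dg].
Qed.

Lemma CkM n O f g : open O -> Ck n O f -> Ck n O g ->
  Ck n O (fun x => f x * g x).
Proof.
move=> oO; elim: n f g => [|n IH] f g Cf Cg.
  by split=> // x Ox; apply: cvgM; apply: Ck_continuous Ox; eassumption.
split=> [x Ox|v].
  by apply: cvgM; apply: Ck_continuous Ox; eassumption.
have df x (Ox : O x) : derivable f x v := Ck_derivable v Cf Ox.
have dg x (Ox : O x) : derivable g x v := Ck_derivable v Cg Ox.
split=> [x Ox|]; first by apply: derivableM; [exact: df | exact: dg].
apply: eq_Ck (CkD oO (IH _ _ (CkS Cf) (Ck_derive v Cg))
                     (IH _ _ (CkS Cg) (Ck_derive v Cf))) => // x Ox.
by symmetry; apply: deriveM; [exact: df | exact: dg].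
Qed.

Lemma CkN n O f : open O -> Ck n O f -> Ck n O (fun x => - f x).
Proof.
move=> oO Cf; apply: eq_Ck (CkM oO (Ck_cst n O (-1)) Cf) => // x _.
by rewrite mulN1r.
Qed.

Lemma Ck_sum n O (I : Type) (s : seq I) (P : pred I) (F : I -> V -> R) :
  open O -> (forall i, Ck n O (F i)) ->
  Ck n O (fun x => \sum_(i <- s | P i) F i x).
Proof.
move=> oO CF; elim: s => [|i s IH].
  by apply: eq_Ck (Ck_cst n O 0) => // x _; rewrite big_nil.
case Pi: (P i); last by apply: eq_Ck IH => // x _; rewrite big_cons Pi.
by apply: eq_Ck (CkD oO (CF i) IH) => // x _; rewrite big_cons Pi.
Qed.

Lemma CkV n O f : open O -> (forall x, O x -> f x != 0) -> Ck n O f ->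
  Ck n O (fun x => (f x)^-1).
Proof.
move=> oO f0; elim: n f f0 => [|n IH] f f0 Cf.
  split=> // x Ox; apply: cvgV; first exact: f0.
  exact: Ck_continuous Cf _ Ox.
split=> [x Ox|v].
  by apply: cvgV; [exact: f0 | exact: Ck_continuous Cf _ Ox].
have df x (Ox : O x) : derivable f x v := Ck_derivable v Cf Ox.
split=> [x Ox|]; first by apply: derivableV; [exact: f0 | exact: df].
have CV := IH _ f0 (CkS Cf).
apply: eq_Ck (CkN oO (CkM oO (CkM oO CV CV) (Ck_derive v Cf))) => // x Ox.
by rewrite deriveV ?f0 //; [rewrite -expr2 exprVn scaleNr | exact: df].
Qed.

Lemma Ck_sqrt n O f : open O -> (forall x, O x -> 0 < f x) -> Ck n O f ->
  Ck n O (fun x => Num.sqrt (f x)).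
Proof.
move=> oO f0; elim: n f f0 => [|n IH] f f0 Cf.
  split=> // x Ox; apply: (@continuous_comp _ _ _ f Num.sqrt).
    exact: Ck_continuous Cf _ Ox.
  exact: sqrt_continuous.
have ds x v (Ox : O x) := is_derive_sqrt (f0 x Ox) (Ck_is_derive v Cf Ox).
split=> [x Ox|v].
  apply: (@continuous_comp _ _ _ f Num.sqrt); last exact: sqrt_continuous.
  exact: Ck_continuous Cf _ Ox.
split=> [x Ox|]; first by have [] := ds x v Ox.
have Cs := IH _ f0 (CkS Cf).
have CV : Ck n O (fun x => (2 * Num.sqrt (f x))^-1).
  apply: CkV => // [x Ox|]; last by apply: CkM => //; exact: Ck_cst.
  by rewrite mulf_neq0 // sqrtr_eq0 -ltNge f0.
apply: eq_Ck (CkM oO (Ck_derive v Cf) CV) => // x Ox.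
by have [_ ->] := ds x v Ox.
Qed.

End Ck_theory.

Arguments Ck_continuous [R V n O f] _ [x] _.
Arguments Ck_derivable [R V n O f] v _ [x] _.

(** * Symmetry of second derivatives and boundary values *)

Lemma is_derive_translate (R : numFieldType) (V W : normedModType R)
    (f : V -> W) (u x v : V) (l : W) :
  is_derive x v (fun y => f (u + y)) l <-> is_derive (u + x) v f l.
Proof.
have E : (fun h : R => h^-1 *: (((fun y => f (u + y)) \o shift x) (h *: v)
      - f (u + x))) =
    (fun h => h^-1 *: ((f \o shift (u + x)) (h *: v) - f (u + x))).
  by apply/funext => h /=; rewrite addrCA.
by split=> -[df dl]; split; rewrite /derivable /derive ?E // -E.
Qed.

Lemma MVT_line (R : realType) (V : normedModType R) (f df : V -> R) (x v : V)
    (t : R) :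
  0 < t ->
  (forall h, 0 <= h <= t -> is_derive (h *: v + x) v f (df (h *: v + x))) ->
  exists2 h, 0 < h < t & f (t *: v + x) - f x = t * df (h *: v + x).
Proof.
move=> t0 fd.
have gd h : 0 <= h <= t ->
    is_derive h 1 (fun h => f (h *: v + x)) (df (h *: v + x)).
  by move=> /fd; rewrite is_derive_line.
have [h|h|h] := @MVT R (fun h => f (h *: v + x)) (fun h => df (h *: v + x)) 0 t t0.
- by rewrite in_itv => /andP[h0 ht]; apply: gd; rewrite !ltW.
- move: h; apply: derivable_within_continuous => h; rewrite in_itv /= => /gd.
  by case.
- rewrite in_itv => hI; rewrite scale0r add0r subr0 => ->.
  by exists h => //; rewrite mulrC.
Qed.

(** The increment [f (y + t w) - f y] is differentiated along [v], and then
    ['D_v f] along [w]. *)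
Lemma second_difference (R : realType) (V : normedModType R) (O : set V)
    (f : V -> R) (x v w : V) (t : R) :
  Ck 2 O f -> 0 < t ->
  (forall a b : R, 0 <= a <= t -> 0 <= b <= t -> O (b *: w + (a *: v + x))) ->
  exists a b : R, [/\ 0 < a < t, 0 < b < t &
    f (t *: w + (t *: v + x)) - f (t *: v + x) - (f (t *: w + x) - f x) =
    t * (t * 'D_w ('D_v f) (b *: w + (a *: v + x)))].
Proof.
move=> Cf t0 OI.
have t0t : 0 <= t <= t by rewrite lexx ltW.
have z0t : (0 : R) <= 0 <= t by rewrite lexx ltW.
have [a ha|a aI ->] := @MVT_line R V (fun y => f (t *: w + y) - f y)
    (fun y => 'D_v f (t *: w + y) - 'D_v f y) x v t t0.
  apply: is_deriveB.
    by apply/is_derive_translate; apply: Ck_is_derive Cf _ _; exact: OI.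
  apply: Ck_is_derive Cf _ _.
  by have := OI a 0 ha z0t; rewrite scale0r add0r.
have aI' : 0 <= a <= t by case/andP: aI => a0 ?; rewrite !ltW.
have [b hb|b bI ->] := @MVT_line R V ('D_v f) ('D_w ('D_v f)) (a *: v + x) w t t0.
  by apply: Ck_is_derive (Ck_derive v Cf) _ _; exact: OI.
by exists a, b.
Qed.

Lemma continuous_separated (R : realType) (V : normedModType R) (O : set V)
    (g h : V -> R) (x : V) :
  open O -> O x -> {for x, continuous g} -> {for x, continuous h} ->
  g x != h x ->
  exists2 r : R, 0 < r & forall y, `|x - y| < r ->
    O y /\ forall z, `|x - z| < r -> g y != h z.
Proof.
move=> oO Ox cg ch; rewrite -subr_eq0 => ne.
have e0 : 0 < `|g x - h x| / 2 by rewrite divr_gt0 // normr_gt0.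
have nO : \near x, O x by exact: open_nbhs_nbhs.
have ng : \forall y \near x, `|g x - g y| < `|g x - h x| / 2.
  by move/cvgrPdist_lt: cg => /(_ _ e0).
have nh : \forall y \near x, `|h x - h y| < `|g x - h x| / 2.
  by move/cvgrPdist_lt: ch => /(_ _ e0).
have /nbhs_normP[r /= r0 rP] : \forall y \near x, [/\ O y,
    `|g x - g y| < `|g x - h x| / 2 & `|h x - h y| < `|g x - h x| / 2].
  by near=> y; split; near: y.
exists r => // y /rP[Oy gy _]; split=> // z /rP[_ _ hz].
apply/eqP => eq; rewrite eq in gy.
have := ler_distD (h z) (g x) (h x).
rewrite (distrC (h z)) leNgt => /negP[]; lra.
Unshelve. all: by end_near. Qed.

(** The two mixed derivatives are limits of the same second difference
    quotient, by the mean value theorem along each of its two axes. *)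
Lemma derive_commute (R : realType) (V : normedModType R) (O : set V)
    (f : V -> R) (x v w : V) :
  open O -> Ck 2 O f -> O x -> 'D_w ('D_v f) x = 'D_v ('D_w f) x.
Proof.
move=> oO Cf Ox; apply/eqP; apply: contraT => ne.
have cg := Ck_continuous (Ck_derive w (Ck_derive v Cf)) Ox.
have ch := Ck_continuous (Ck_derive v (Ck_derive w Cf)) Ox.
have [r r0 rP] := continuous_separated oO Ox cg ch ne.
(* All points of the parallelogram with sides [t v] and [t w] at [x] lie
   within [r] of [x]. *)
pose t := r / (`|v| + `|w| + 1).
have N0 : 0 < `|v| + `|w| + 1 by rewrite ltr_wpDl // addr_ge0.
have t0 : 0 < t by rewrite divr_gt0.
have near_x (a b : R) : 0 <= a <= t -> 0 <= b <= t ->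
    `|x - (b *: w + (a *: v + x))| < r.
  move=> /andP[a0 at_] /andP[b0 bt].
  have -> : x - (b *: w + (a *: v + x)) = - (b *: w + a *: v).
    by rewrite addrA opprD addrCA subrr addr0.
  rewrite normrN; apply: le_lt_trans (ler_normD _ _) _.
  rewrite !normrZ (ger0_norm a0) (ger0_norm b0).
  have -> : r = t * (`|v| + `|w| + 1) by rewrite /t divfK // gt_eqF.
  rewrite !mulrDr mulr1 addrC ltr_pwDr // lerD // ler_wpM2r //.
have weak (a : R) : 0 < a < t -> 0 <= a <= t.
  by case/andP => a0 ?; rewrite !ltW.
have [|a [b [aI bI eg]]] := @second_difference R V O f x v w t Cf t0.
  by move=> a b aI bI; have [] := rP _ (near_x a b aI bI).
have swap (a' b' : R) : b' *: w + (a' *: v + x) = a' *: v + (b' *: w + x).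
  by rewrite addrCA.
have [|b' [a' [bI' aI' eh]]] := @second_difference R V O f x w v t Cf t0.
  by move=> b' a' bI' aI'; rewrite -swap; have [] := rP _ (near_x a' b' aI' bI').
have [_ /(_ _ (near_x a' b' (weak _ aI') (weak _ bI')))/eqP[]] :=
  rP _ (near_x a b (weak _ aI) (weak _ bI)).
rewrite -(swap a' b') -(swap t t) in eh.
have t00 : t != 0 by rewrite gt_eqF.
move: eg eh; move: ('D_w ('D_v f) _) ('D_v ('D_w f) _) => G H eg eh.
by apply: (mulfI t00); apply: (mulfI t00); rewrite -eg -eh; ring.
Qed.

Lemma eq_at_closure (R : realType) (V : normedModType R) (A : set V)
    (f g : V -> R) (x : V) :
  closure A x -> {for x, continuous f} -> {for x, continuous g} ->
  (forall y, A y -> f y = g y) -> f x = g x.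
Proof.
move=> clx cf cg fg; apply/eqP; rewrite -subr_eq0; apply: contraT => ne.
have e0 : 0 < `|f x - g x| by rewrite normr_gt0.
have cD : {for x, continuous (fun y => f y - g y)} by exact: cvgB.
move/cvgrPdist_lt: cD => /(_ _ e0) /clx [y [Ay /=]].
by rewrite (fg y Ay) subrr subr0 ltxx.
Qed.

(** Derivatives are limits of their values at interior points, which only see
    the functions on the interior. *)
Lemma derive_eq_on_closure (R : realType) (V : normedModType R) (U O : set V)
    (f g : V -> R) (v : V) :
  U `<=` O -> U = closure U° -> Ck 1 O f -> Ck 1 O g ->
  (forall x, U x -> f x = g x) -> forall x, U x -> 'D_v f x = 'D_v g x.
Proof.
move=> UO Ucl Cf Cg fg x Ux.
apply: (@eq_at_closure _ _ U° ('D_v f) ('D_v g) x); first by move: Ux; rewrite {1}Ucl.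
- by have /(_ x (UO _ Ux)) := Ck_continuous (Ck_derive v Cf).
- by have /(_ x (UO _ Ux)) := Ck_continuous (Ck_derive v Cg).
move=> y Uy; apply: near_eq_derive; near=> z; apply: fg.
by near: z; exact: Uy.
Unshelve. all: by end_near. Qed.

(** * Coordinates and slices of smooth maps *)

Section smooth_coordinates.
Variables (R : realType) (V : normedModType R).
Implicit Types (O : set V) (n : nat).

Lemma smooth_on_derive (W : normedModType R) O (f : V -> W) v :
  smooth_on O f -> smooth_on O ('D_v f).
Proof.
move=> sf vs x Ox; have := sf (rcons vs v) x Ox.
by rewrite /iter_derive foldr_rcons.
Qed.

Lemma smooth_on_Ck n O (f : V -> R) : smooth_on O f -> Ck n O f.
Proof.
elim: n f => [|n IH] f sf; first by split=> // x /(sf [::])[].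
split=> [x /(sf [::])[] //|v]; split=> [x /(sf [::])[_]|]; first exact.
by apply: IH; exact: smooth_on_derive.
Qed.

Lemma derive_coord m (f : V -> 'rV[R]_m) x v k :
  derivable f x v -> 'D_v (fun y => f y 0 k) x = 'D_v f x 0 k.
Proof. by move=> df; rewrite derive_mx // mxE. Qed.

Lemma smooth_on_derive_coord m O (f : V -> 'rV[R]_m) x v k :
  smooth_on O f -> O x -> 'D_v (fun y => f y 0 k) x = 'D_v f x 0 k.
Proof. by move=> /(_ [::] x)/[apply] -[_ df]; apply: derive_coord; exact: df. Qed.

Lemma smooth_on_Ck_coord n m O (f : V -> 'rV[R]_m) k :
  open O -> smooth_on O f -> Ck n O (fun x => f x 0 k).
Proof.
move=> oO; elim: n f => [|n IH] f sf.
  split=> // x /(sf [::])[cf _].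
  by apply: (@continuous_comp _ _ _ f (fun M => M 0 k)) => //; exact: coord_continuous.
split=> [x /(sf [::])[cf _]|v].
  by apply: (@continuous_comp _ _ _ f (fun M => M 0 k)) => //; exact: coord_continuous.
split=> [x /(sf [::])[_ df]|].
  by move: (df v) => /derivable_mxP; exact.
apply: eq_Ck (IH _ (smooth_on_derive v sf)) => // x Ox.
by rewrite (smooth_on_derive_coord v k sf Ox).
Qed.

End smooth_coordinates.

Section slices.
Variables (R : realType) (S T : normedModType R).

Lemma quotient_slice_r (W : normedModType R) (f : S * T -> W) s t v :
  (fun h : R => h^-1 *: (((fun t => f (s, t)) \o shift t) (h *: v) - f (s, t))) =
  (fun h : R => h^-1 *: ((f \o shift (s, t)) (h *: (0, v)) - f (s, t))).
Proof.
apply/funext => h /=; congr (_ *: (f _ - _)).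
by apply/pair_equal_spec; rewrite /= scaler0 add0r.
Qed.

Lemma derive_slice_r (W : normedModType R) (f : S * T -> W) s t v :
  'D_v (fun t => f (s, t)) t = 'D_(0, v) f (s, t).
Proof. by rewrite /derive quotient_slice_r. Qed.

Lemma derivable_slice_r (W : normedModType R) (f : S * T -> W) s t v :
  derivable f (s, t) (0, v) -> derivable (fun t => f (s, t)) t v.
Proof. by rewrite /derivable quotient_slice_r. Qed.

Lemma Ck_slice_r n (P : set (S * T)) (f : S * T -> R) s :
  Ck n P f -> Ck n [set t | P (s, t)] (fun t => f (s, t)).
Proof.
have cont (g : S * T -> R) : (forall p, P p -> {for p, continuous g}) ->
    forall t, P (s, t) -> {for t, continuous (fun t => g (s, t))}.
  move=> cg t Pt; apply: (@continuous_comp _ _ _ (pair s) g); last exact: cg.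
  exact: continuous_pair.
elim: n f => [|n IH] f [cf df]; first by split=> //; exact: cont.
split=> [|v]; first exact: cont.
have [dv cv] := df (0, v); split=> [t Pt|].
  by apply: derivable_slice_r; exact: dv.
have -> : 'D_v (fun t => f (s, t)) = fun t => 'D_(0, v) f (s, t).
  by apply/funext => t; exact: derive_slice_r.
exact: (IH ('D_(0, v) f)) cv.
Qed.

End slices.

Section time_slices.
Variables (R : realType) (T : normedModType R).

Lemma quotient_slice_l (W : normedModType R) (f : R * T -> W) (s : R) (t : T) :
  (fun h : R => h^-1 *: (((fun s => f (s, t)) \o shift s) (h *: 1) - f (s, t))) =
  (fun h : R => h^-1 *: ((f \o shift (s, t)) (h *: (1, 0)) - f (s, t))).
Proof.
apply/funext => h /=; congr (_ *: (f _ - _)).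
by apply/pair_equal_spec; rewrite /= scaler0 add0r.
Qed.

Lemma derive_slice_l (W : normedModType R) (f : R * T -> W) (s : R) (t : T) :
  'D_1 (fun s => f (s, t)) s = 'D_(1, 0) f (s, t).
Proof. by rewrite /derive quotient_slice_l. Qed.

Lemma is_derive_slice_l (W : normedModType R) (f : R * T -> W) (s : R) (t : T) l :
  is_derive (s, t) (1, 0) f l -> is_derive s 1 (fun s => f (s, t)) l.
Proof.
by move=> [df <-]; apply: DeriveDef; [move: df; rewrite /derivable quotient_slice_l
  | exact: derive_slice_l].
Qed.

End time_slices.

(** * Vector fields and the Minkowski product *)

(** Coordinates turn vector fields into real functions; all derivatives of
    vector fields below are computed coordinatewise. *)
Definition Ckv (R : realType) (V : normedModType R) (m n : nat) (O : set V)
    (f : V -> 'rV[R]_m) : Prop :=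
  forall k, Ck n O (fun x => f x 0 k).

Section vector_fields.
Variables (R : realType) (V : normedModType R) (m : nat).
Implicit Types (O : set V) (f g : V -> 'rV[R]_m) (n : nat).

Lemma smooth_on_Ckv n O f : open O -> smooth_on O f -> Ckv n O f.
Proof. by move=> oO sf k; exact: smooth_on_Ck_coord. Qed.

Lemma Ckv_derivable n O f v x : Ckv n.+1 O f -> O x -> derivable f x v.
Proof.
move=> Cf Ox; apply/derivable_mxP => i k; rewrite (ord1 i).
exact: (Ck_derivable v (Cf k) Ox).
Qed.

Lemma Ckv_derive_coord n O f v x k :
  Ckv n.+1 O f -> O x -> 'D_v (fun y => f y 0 k) x = 'D_v f x 0 k.
Proof. by move=> Cf Ox; apply: derive_coord; exact: Ckv_derivable Cf Ox. Qed.

Lemma Ckv_derive n O f v : open O -> Ckv n.+1 O f -> Ckv n O ('D_v f).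
Proof.
move=> oO Cf k; apply: eq_Ck (Ck_derive v (Cf k)) => // x Ox.
exact: Ckv_derive_coord Cf Ox.
Qed.

Lemma CkvS n O f : Ckv n.+1 O f -> Ckv n O f.
Proof. by move=> Cf k; exact: CkS. Qed.

Lemma Ckv_subset n O O' f : O' `<=` O -> Ckv n O f -> Ckv n O' f.
Proof. by move=> sO Cf k; exact: Ck_subset (Cf k). Qed.

Lemma CkvD n O f g : open O -> Ckv n O f -> Ckv n O g ->
  Ckv n O (fun x => f x + g x).
Proof.
move=> oO Cf Cg k; apply: eq_Ck (CkD oO (Cf k) (Cg k)) => // x _.
by rewrite mxE.
Qed.

Lemma CkvN n O f : open O -> Ckv n O f -> Ckv n O (fun x => - f x).
Proof.
by move=> oO Cf k; apply: eq_Ck (CkN oO (Cf k)) => // x _; rewrite mxE.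
Qed.

Lemma CkvZ n O (a : V -> R) f : open O -> Ck n O a -> Ckv n O f ->
  Ckv n O (fun x => a x *: f x).
Proof.
by move=> oO Ca Cf k; apply: eq_Ck (CkM oO Ca (Cf k)) => // x _; rewrite mxE.
Qed.

Lemma Ckv_deriveZ O (a : V -> R) f v x : open O -> Ck 1 O a -> Ckv 1 O f ->
  O x -> 'D_v (fun y => a y *: f y) x = 'D_v a x *: f x + a x *: 'D_v f x.
Proof.
move=> oO Ca Cf Ox; apply/rowP => k.
rewrite -(Ckv_derive_coord v k (CkvZ oO Ca Cf) Ox) !mxE.
under eq_fun do rewrite mxE.
rewrite -(Ckv_derive_coord v k Cf Ox).
rewrite (deriveM (Ck_derivable v Ca Ox) (Ck_derivable v (Cf k) Ox)).
by rewrite addrC; congr (_ + _); exact: mulrC.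
Qed.

Lemma Ckv_derive_commute O f v w x : open O -> Ckv 2 O f -> O x ->
  'D_w ('D_v f) x = 'D_v ('D_w f) x.
Proof.
move=> oO Cf Ox; apply/rowP => k.
have E (a b : V) : 'D_b ('D_a f) x 0 k = 'D_b ('D_a (fun y => f y 0 k)) x.
  rewrite -(Ckv_derive_coord b k (Ckv_derive a oO Cf) Ox).
  apply: near_eq_derive; have nO : \near x, O x by exact: open_nbhs_nbhs.
  near=> y; rewrite (Ckv_derive_coord a k Cf) //; near: y; exact: nO.
refine (etrans (E v w) _).
refine (etrans _ (esym (E w v))).
exact: (derive_commute v w oO (Cf k) Ox).
Unshelve. all: by end_near. Qed.

Lemma Ckv_derive_eq_on_closure (U O : set V) f g v :
  U `<=` O -> U = closure U° -> Ckv 1 O f -> Ckv 1 O g ->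
  (forall x, U x -> f x = g x) -> forall x, U x -> 'D_v f x = 'D_v g x.
Proof.
move=> UO Ucl Cf Cg fg x Ux; apply/rowP => k.
rewrite -(Ckv_derive_coord v k Cf (UO _ Ux)).
rewrite -(Ckv_derive_coord v k Cg (UO _ Ux)).
by apply: (derive_eq_on_closure _ UO Ucl (Cf k) (Cg k)) => // y /fg ->.
Qed.

End vector_fields.

Lemma Ckv_slice_r (R : realType) (S T : normedModType R) (m n : nat)
    (P : set (S * T)) (f : S * T -> 'rV[R]_m) (s : S) :
  Ckv n P f -> Ckv n [set t | P (s, t)] (fun t => f (s, t)).
Proof. by move=> Cf k; exact: (Ck_slice_r s (Cf k)). Qed.

Section minkowski.
Variable R : realType.


Definition mink_sign (k : 'I_4) : R := if k == 0 then -1 else 1.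

Lemma minkE (x y : 'rV[R]_4) : mink x y = \sum_k mink_sign k * (x 0 k * y 0 k).
Proof.
rewrite /mink [RHS](bigD1 0) //= mulN1r; congr (_ + _).
by apply: eq_bigr => i /negbTE i0; rewrite /mink_sign i0 mul1r.
Qed.

Lemma minkC (x y : 'rV[R]_4) : mink x y = mink y x.
Proof. by rewrite !minkE; apply: eq_bigr => k _; rewrite (mulrC (x _ _)). Qed.

Lemma minkDl (x y z : 'rV[R]_4) : mink (x + y) z = mink x z + mink y z.
Proof.
by rewrite !minkE -big_split /=; apply: eq_bigr => k _; rewrite mxE; ring.
Qed.

Lemma minkZl (a : R) (x y : 'rV[R]_4) : mink (a *: x) y = a * mink x y.
Proof.
by rewrite !minkE mulr_sumr; apply: eq_bigr => k _; rewrite mxE; ring.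
Qed.

Lemma minkDr (x y z : 'rV[R]_4) : mink x (y + z) = mink x y + mink x z.
Proof. by rewrite minkC minkDl !(minkC x). Qed.

Lemma minkZr (a : R) (x y : 'rV[R]_4) : mink x (a *: y) = a * mink x y.
Proof. by rewrite minkC minkZl minkC. Qed.

Lemma minkNl (x y : 'rV[R]_4) : mink (- x) y = - mink x y.
Proof. by rewrite -scaleN1r minkZl mulN1r. Qed.

Lemma minkNr (x y : 'rV[R]_4) : mink x (- y) = - mink x y.
Proof. by rewrite minkC minkNl minkC. Qed.

Lemma mink_sumr n (F : 'I_n -> 'rV[R]_4) x :
  mink x (\sum_i F i) = \sum_i mink x (F i).
Proof.
apply: (big_morph (mink x) (minkDr x)).
by rewrite -(scale0r 0) minkZr mul0r.
Qed.

Section mink_fields.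
Variables (V : normedModType R) (O : set V) (oO : open O).
Implicit Types (f g : V -> 'rV[R]_4) (n : nat).

Lemma Ck_mink n f g : Ckv n O f -> Ckv n O g ->
  Ck n O (fun x => mink (f x) (g x)).
Proof.
move=> Cf Cg; under eq_fun do rewrite minkE.
apply: Ck_sum => // k; apply: CkM => //; first exact: Ck_cst.
exact: CkM.
Qed.

Lemma derive_mink f g v x : Ckv 1 O f -> Ckv 1 O g -> O x ->
  'D_v (fun y => mink (f y) (g y)) x =
  mink ('D_v f x) (g x) + mink (f x) ('D_v g x).
Proof.
move=> Cf Cg Ox; under eq_fun do rewrite minkE.
have df k := Ck_derivable v (Cf k) Ox.
have dg k := Ck_derivable v (Cg k) Ox.
have dfg k : is_derive x v (fun y => mink_sign k * (f y 0 k * g y 0 k))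
    (mink_sign k * ('D_v f x 0 k * g x 0 k + f x 0 k * 'D_v g x 0 k)).
  rewrite -(Ckv_derive_coord v k Cf Ox) -(Ckv_derive_coord v k Cg Ox).
  have dM := derivableM (df k) (dg k).
  apply: DeriveDef; first exact: (derivableM (derivable_cst _ _ _) dM).
  rewrite (deriveM (derivable_cst (mink_sign k) x v) dM).
  rewrite (deriveM (df k) (dg k)) derive_cst scaler0 addr0.
  by congr (_ * _); rewrite addrC; congr (_ + _); exact: mulrC.
have -> : (fun y => \sum_k mink_sign k * (f y 0 k * g y 0 k)) =
    \sum_k (fun y => mink_sign k * (f y 0 k * g y 0 k)).
  by apply/funext => y; rewrite fct_sumE.
rewrite derive_sum => [|k]; last by case: (dfg k).
rewrite !minkE -big_split /=; apply: eq_bigr => k _.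
by case: (dfg k) => _ ->; ring.
Qed.

End mink_fields.

End minkowski.

(** * Lightlike normals and the shape matrix *)

Section normal_frame_completeness.
Variable R : realType.
Implicit Types (x y z t s : 'rV[R]_4).

Definition mink_mx : 'M[R]_4 := diag_mx (\row_k mink_sign R k).

Lemma mink_mxE m n (A : 'M[R]_(m, 4)) (B : 'M[R]_(n, 4)) i j :
  (A *m mink_mx *m B^T) i j = mink (row i A) (row j B).
Proof.
rewrite minkE mxE; apply: eq_bigr => k _.
by rewrite mul_mx_diag !mxE; ring.
Qed.

(** The Gram matrix of the four vectors is block diagonal and invertible, so
    they form a basis, and the form is nondegenerate. *)
Lemma frame_nondegenerate (T : 'I_2 -> 'rV[R]_4) t s z :
  mink s s = 1 -> mink t t = - 1 -> mink t s = 0 ->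
  (forall i, mink t (T i) = 0) -> (forall i, mink s (T i) = 0) ->
  (\matrix_(i < 2, j < 2) mink (T i) (T j)) \in unitmx ->
  mink z t = 0 -> mink z s = 0 -> (forall i, mink z (T i) = 0) -> z = 0.
Proof.
move=> ss tt ts tT sT gu zt zs zT.
pose N : 'M[R]_(2, 4) := \matrix_(i < 2) (if i == 0 then t else s).
pose A : 'M[R]_(2, 4) := \matrix_(i < 2) T i.
pose B : 'M[R]_(2 + 2, 4) := col_mx A N.
have AA : A *m mink_mx *m A^T = \matrix_(i, j) mink (T i) (T j).
  by apply/matrixP => i j; rewrite mink_mxE !rowK mxE.
have AN : A *m mink_mx *m N^T = 0.
  apply/matrixP => i j; rewrite mink_mxE !rowK mxE minkC.
  by case: ifP.
have NA : N *m mink_mx *m A^T = 0.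
  by apply/matrixP => i j; rewrite mink_mxE !rowK mxE; case: ifP.
have NN : N *m mink_mx *m N^T = diag_mx (\row_i (if i == 0 then -1 else 1)).
  apply/matrixP => i j; rewrite mink_mxE !rowK !mxE.
  by case: (unliftP 0 i) => [i'|] ->; case: (unliftP 0 j) => [j'|] ->;
    rewrite ?(ord1 i') ?(ord1 j') //= ?mulr0n ?mulr1n // minkC.
have Bu : (mink_mx *m B^T : 'M[R]_4) \in unitmx.
  have GB : B *m (mink_mx *m B^T) = block_mx (\matrix_(i, j) mink (T i) (T j)) 0
      0 (diag_mx (\row_i (if i == 0 then -1 else 1))).
    by rewrite mulmxA tr_col_mx mul_col_mx mul_col_row AA AN NA NN.
  have : B *m (mink_mx *m B^T) \in unitmx.
    rewrite GB unitmxE det_ublock unitrM -unitmxE gu /= det_diag.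
    by rewrite big_ord_recl big_ord1 !mxE /= mulr1 unitrN unitr1.
  by rewrite (@unitmx_mul R 4 B) => /andP[].
have zB : z *m (mink_mx *m B^T) = 0.
  rewrite mulmxA tr_col_mx mul_mx_row.
  have -> : z *m mink_mx *m A^T = 0.
    by apply/matrixP => i j; rewrite (ord1 i) mink_mxE rowK row_id mxE.
  have -> : z *m mink_mx *m N^T = 0.
    apply/matrixP => i j; rewrite (ord1 i) mink_mxE rowK row_id mxE.
    by case: ifP.
  exact: row_mx0.
by rewrite -(mulmxK Bu z) [X in X *m _]zB mul0mx.
Qed.

(** A vector orthogonal to the lightlike normal [t + s] has normal part a
    multiple of [t + s], which is orthogonal to itself and to the other vector;
    only the tangential parts contribute to the product. *)
Lemma mink_orthogonal_lightlike (T : 'I_2 -> 'rV[R]_4) t s z z' :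
  mink s s = 1 -> mink t t = - 1 -> mink t s = 0 ->
  (forall i, mink t (T i) = 0) -> (forall i, mink s (T i) = 0) ->
  let g := \matrix_(i < 2, j < 2) mink (T i) (T j) in
  g \in unitmx -> mink z (t + s) = 0 -> mink z' (t + s) = 0 ->
  mink z z' =
  \sum_j ((\row_i mink z (T i)) *m invmx g) 0 j * mink (T j) z'.
Proof.
move=> ss tt ts tT sT g gu zl z'l.
set c := _ *m invmx g.
have cg k : \sum_j c 0 j * mink (T j) (T k) = mink z (T k).
  have : (c *m g) 0 k = mink z (T k) by rewrite /c mulmxKV // mxE.
  move=> <-; rewrite mxE; apply: eq_bigr => j _; congr (_ * _).
  by rewrite /g mxE.
have sumT y : mink y (\sum_j c 0 j *: T j) = \sum_j c 0 j * mink (T j) y.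
  by rewrite mink_sumr; apply: eq_bigr => j _; rewrite minkZr minkC.
have sum0 y : (forall j, mink y (T j) = 0) -> \sum_j c 0 j * mink (T j) y = 0.
  by move=> y0; apply: big1 => j _; rewrite minkC y0 mulr0.
(* [r] is [z] minus its expansion in the basis; the signs on [t] and [s] are
   those of their squares. *)
pose r := z - \sum_j c 0 j *: T j + mink z t *: t - mink z s *: s.
have rE y : mink r y = mink z y - \sum_j c 0 j * mink (T j) y +
    mink z t * mink t y - mink z s * mink s y.
  by rewrite /r !(minkDl, minkNl, minkZl) -sumT (minkC y).
have r0 : r = 0.
  apply: (frame_nondegenerate ss tt ts tT sT gu).
  - by rewrite rE sum0 // tt (minkC s) ts; ring.
  - by rewrite rE sum0 // ss ts; ring.
  - by move=> k; rewrite rE cg tT sT; ring.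
have := rE z'; rewrite r0 -(scale0r 0) minkZl mul0r.
move: zl z'l; rewrite !minkDr (minkC z' t) (minkC z' s).
move=> /eqP; rewrite addr_eq0 => /eqP ->.
move=> /eqP; rewrite addr_eq0 => /eqP -> /esym /eqP.
by rewrite mulrNN addrK subr_eq0 => /eqP.
Qed.

End normal_frame_completeness.

Section shape_matrix.
Variables (R : realType) (X n : R * R -> 'rV[R]_4) (u : R * R).
Hypothesis gu : first_form X u \in unitmx.

Lemma tangent_coord_proj z :
  tangent_coord X u (tangent_proj X u z) = tangent_coord X u z.
Proof.
rewrite {1}/tangent_coord.
suff -> : \row_i mink (tangent_proj X u z) (partial i X u) =
    tangent_coord X u z *m first_form X u by rewrite mulmxK.
apply/rowP => k; rewrite mxE [RHS]mxE /tangent_proj minkC mink_sumr.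
apply: eq_bigr => j _; rewrite minkZr minkC; congr (_ * _).
by rewrite mxE.
Qed.

Lemma tangent_coordN z : tangent_coord X u (- z) = - tangent_coord X u z.
Proof.
rewrite /tangent_coord -mulNmx; congr (_ *m _).
by apply/rowP => i; rewrite !mxE minkNl.
Qed.

Lemma shape_mx_row i k :
  shape_mx X n u i k = - tangent_coord X u (partial i n u) 0 k.
Proof. by rewrite mxE /shape tangent_coordN tangent_coord_proj mxE. Qed.

Lemma shape_mx_second_form :
  shape_mx X n u *m first_form X u =
  - \matrix_(i, j) mink (partial i n u) (partial j X u).
Proof.
apply/matrixP => i k; rewrite mxE.
under eq_bigr => j _ do rewrite (shape_mx_row i j) mulNr.
rewrite sumrN mxE; congr (- _).
have -> : \sum_j tangent_coord X u (partial i n u) 0 j * first_form X u j k =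
  (tangent_coord X u (partial i n u) *m first_form X u) 0 k by rewrite mxE.
by rewrite /tangent_coord mulmxKV // !mxE.
Qed.

End shape_matrix.

Lemma det_mx22 (R : comNzRingType) (A : 'M[R]_2) :
  \det A = A 0 0 * A 1 1 - A 0 1 * A 1 0.
Proof.
rewrite (expand_det_row _ 0) big_ord_recl big_ord1 /cofactor !det_mx11 !mxE /=.
rewrite expr0 expr1 mul1r mulN1r mulrN.
by congr (A _ _ * A _ _ - A _ _ * A _ _); exact/val_inj.
Qed.

(** Here [h = S g] is the second fundamental form of the lightlike normal, and
    [S h] is its third fundamental form.  As [S] is trace free, [S ^ 2] is
    [- det S] times the identity by the Cayley-Hamilton theorem. *)
Lemma metric_det_variation (R : comNzRingType) (g g1 g2 S h : 'M[R]_2) (a b : R) :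
  g 1 0 = g 0 1 -> h = S *m g -> h 1 0 = h 0 1 -> \tr S = 0 ->
  g1 = (- 2 * a) *: h -> g2 = (- 2 * b) *: h + (2 * a ^+ 2) *: (S *m h) ->
  g1 0 0 * g 1 1 + g 0 0 * g1 1 1 - 2 * (g 0 1 * g1 0 1) = 0 /\
  g2 0 0 * g 1 1 + 2 * (g1 0 0 * g1 1 1) + g 0 0 * g2 1 1
    - 2 * (g1 0 1 * g1 0 1) - 2 * (g 0 1 * g2 0 1) =
  4 * (a ^+ 2 * \det S * (g 0 0 * g 1 1 - g 0 1 * g 0 1)).
Proof.
have mul2 (A B : 'M[R]_2) i j : (A *m B) i j = A i 0 * B 0 j + A i 1 * B 1 j.
  by rewrite mxE big_ord_recl big_ord1 (_ : lift _ _ = 1) //; exact/val_inj.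
move=> gs hE hs tr -> ->.
have h00 : h 0 0 = S 0 0 * g 0 0 + S 0 1 * g 0 1 by rewrite hE mul2 gs.
have h01 : h 0 1 = S 0 0 * g 0 1 + S 0 1 * g 1 1 by rewrite hE mul2.
have h10 : h 1 0 = S 1 0 * g 0 0 + S 1 1 * g 0 1 by rewrite hE mul2 gs.
have h11 : h 1 1 = S 1 0 * g 0 1 + S 1 1 * g 1 1 by rewrite hE mul2.
have S11 : S 1 1 = - S 0 0.
  apply/eqP; rewrite -addr_eq0 -tr /mxtrace big_ord_recl big_ord1.
  by rewrite addrC (_ : lift _ _ = 1) ?eqxx //; exact/val_inj.
have ZE (c : R) (A : 'M[R]_2) i j : (c *: A) i j = c * A i j by rewrite mxE.
have DE (A B : 'M[R]_2) i j : (A + B) i j = A i j + B i j by rewrite mxE.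
rewrite det_mx22 !DE !ZE !mul2 hs.
(* The derivative of the determinant at [g] in the direction [S g] is [\tr S]
   times the determinant of [g]. *)
have polar : h 0 0 * g 1 1 + g 0 0 * h 1 1 - 2 * (g 0 1 * h 0 1) = 0.
  have -> : 2 * (g 0 1 * h 0 1) = g 0 1 * h 0 1 + g 0 1 * h 1 0 by rewrite hs; ring.
  by rewrite h00 h01 h10 h11 S11; ring.
have det : h 0 0 * h 1 1 - h 0 1 * h 0 1 =
    (S 0 0 * S 1 1 - S 0 1 * S 1 0) * (g 0 0 * g 1 1 - g 0 1 * g 0 1).
  by rewrite -{2}hs h00 h01 h10 h11; ring.
split; first by rewrite -[RHS](mulr0 (- 2 * a)) -polar; ring.
(* The same derivative in the direction [S h = S ^ 2 g]. *)
have third : (S 0 0 * h 0 0 + S 0 1 * h 0 1) * g 1 1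
    + g 0 0 * (S 1 0 * h 0 1 + S 1 1 * h 1 1)
    - 2 * (g 0 1 * (S 0 0 * h 0 1 + S 0 1 * h 1 1)) =
    - 2 * (S 0 0 * S 1 1 - S 0 1 * S 1 0) * (g 0 0 * g 1 1 - g 0 1 * g 0 1).
  by rewrite -{1}hs h00 h01 h10 h11 S11; ring.
have -> : 4 * (a ^+ 2 * (S 0 0 * S 1 1 - S 0 1 * S 1 0) *
    (g 0 0 * g 1 1 - g 0 1 * g 0 1)) =
  - 2 * b * (h 0 0 * g 1 1 + g 0 0 * h 1 1 - 2 * (g 0 1 * h 0 1)) +
  2 * a ^+ 2 * (- 2 * (S 0 0 * S 1 1 - S 0 1 * S 1 0) * (g 0 0 * g 1 1 - g 0 1 * g 0 1))
  + 8 * a ^+ 2 * (h 0 0 * h 1 1 - h 0 1 * h 0 1).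
  by rewrite polar det; ring.
by rewrite -third; ring.
Qed.

(** * Second derivatives of products *)

Section second_derivatives.
Variables (R : realType) (V : normedModType R) (O : set V) (oO : open O).
Variables (v : V) (x : V).
Hypothesis Ox : O x.

Let near_O : \near x, O x. Proof. exact: open_nbhs_nbhs. Qed.

Lemma derive2M (f g : V -> R) : Ck 2 O f -> Ck 2 O g ->
  'D_v ('D_v (fun y => f y * g y)) x =
  'D_v ('D_v f) x * g x + 2 * ('D_v f x * 'D_v g x) + f x * 'D_v ('D_v g) x.
Proof.
move=> Cf Cg.
have Cf' := Ck_derive v Cf; have Cg' := Ck_derive v Cg.
have M (h k : V -> R) y : Ck 1 O h -> Ck 1 O k -> O y ->
    'D_v (fun y => h y * k y) y = h y * 'D_v k y + k y * 'D_v h y.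
  move=> Ch Ck Oy.
  exact: (deriveM (Ck_derivable v Ch Oy) (Ck_derivable v Ck Oy)).
have -> : 'D_v ('D_v (fun y => f y * g y)) x =
    'D_v (fun y => f y * 'D_v g y + g y * 'D_v f y) x.
  apply: near_eq_derive; near=> y; apply: M; [exact: CkS|exact: CkS|near: y].
  exact: near_O.
have d1 := Ck_derivable v (CkM oO (CkS Cf) Cg') Ox.
have d2 := Ck_derivable v (CkM oO (CkS Cg) Cf') Ox.
refine (etrans (deriveD d1 d2) _).
refine (etrans (congr2 +%R (M _ _ x (CkS Cf) Cg' Ox) (M _ _ x (CkS Cg) Cf' Ox)) _).
move: ('D_v ('D_v f) x) ('D_v ('D_v g) x) ('D_v f x) ('D_v g x) => f2 g2 f1 g1.
by ring.
Unshelve. all: by end_near. Qed.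

Lemma derive2B (f g : V -> R) : Ck 2 O f -> Ck 2 O g ->
  'D_v ('D_v (fun y => f y - g y)) x = 'D_v ('D_v f) x - 'D_v ('D_v g) x.
Proof.
move=> Cf Cg.
have -> : 'D_v ('D_v (fun y => f y - g y)) x =
    'D_v (fun y => 'D_v f y - 'D_v g y) x.
  apply: near_eq_derive; near=> y; apply: deriveB.
    by apply: (Ck_derivable v Cf); near: y; exact: near_O.
  by apply: (Ck_derivable v Cg); near: y; exact: near_O.
exact: (deriveB (Ck_derivable v (Ck_derive v Cf) Ox)
                (Ck_derivable v (Ck_derive v Cg) Ox)).
Unshelve. all: by end_near. Qed.

(** Obtained from the product rule for [Num.sqrt (f y) ^ 2 = f y]. *)
Lemma derive2_sqrt (f : V -> R) : (forall y, O y -> 0 < f y) -> Ck 2 O f ->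
  'D_v f x = 0 ->
  'D_v ('D_v (fun y => Num.sqrt (f y))) x =
  'D_v ('D_v f) x / (2 * Num.sqrt (f x)).
Proof.
move=> f0 Cf fx.
have Cs := Ck_sqrt oO f0 Cf.
have s0 : Num.sqrt (f x) != 0 by rewrite sqrtr_eq0 -ltNge f0.
have sx : 'D_v (fun y => Num.sqrt (f y)) x = 0.
  have [_ ->] := is_derive_sqrt (f0 x Ox) (Ck_is_derive v Cf Ox).
  by rewrite fx mul0r.
have := derive2M Cs Cs; rewrite sx mul0r mulr0 addr0.
have -> : 'D_v ('D_v (fun y => Num.sqrt (f y) * Num.sqrt (f y))) x =
    'D_v ('D_v f) x.
  apply: near_eq_derive; near=> y.
  have Oy : O y by near: y; exact: near_O.
  apply: near_eq_derive; have nO : \near y, O y by exact: open_nbhs_nbhs.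
  near=> z; rewrite -expr2 sqr_sqrtr // ltW // f0 //; near: z; exact: nO.
move=> ->; move: ('D_v ('D_v (fun y => Num.sqrt (f y))) x) => D.
by field.
Unshelve. all: by end_near. Qed.

Lemma derive2_mink (f g : V -> 'rV[R]_4) : Ckv 2 O f -> Ckv 2 O g ->
  'D_v ('D_v (fun y => mink (f y) (g y))) x =
  mink ('D_v ('D_v f) x) (g x) + 2 * mink ('D_v f x) ('D_v g x) +
  mink (f x) ('D_v ('D_v g) x).
Proof.
move=> Cf Cg.
have Cf' := Ckv_derive v oO Cf; have Cg' := Ckv_derive v oO Cg.
have Cf1 := CkvS Cf; have Cg1 := CkvS Cg.
have -> : 'D_v ('D_v (fun y => mink (f y) (g y))) x =
    'D_v (fun y => mink ('D_v f y) (g y) + mink (f y) ('D_v g y)) x.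
  apply: near_eq_derive; near=> y; apply: (derive_mink v Cf1 Cg1).
  by near: y; exact: near_O.
have d1 := Ck_derivable v (Ck_mink oO Cf' Cg1) Ox.
have d2 := Ck_derivable v (Ck_mink oO Cf1 Cg') Ox.
refine (etrans (deriveD d1 d2) _).
refine (etrans (congr2 +%R (derive_mink v Cf' Cg1 Ox)
                           (derive_mink v Cf1 Cg' Ox)) _).
move: (mink ('D_v ('D_v f) x) _) (mink ('D_v f x) _) => s t.
by ring.
Unshelve. all: by end_near. Qed.

End second_derivatives.

(** * Lightlike variations at time zero *)

(** In this section [v] and [w] stand for the velocity and the acceleration of
    the variation at time zero, and [l] for a lightlike normal field. *)
Section lightlike_variation.
Variables (R : realType) (U O : set (R * R)).
Hypotheses (oO : open O) (UO : U `<=` O) (Ucl : U = closure U°).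
Variables (X v w nT nS : R * R -> 'rV[R]_4) (a : R * R -> R).
Let l u := nT u + nS u.
Hypotheses (CX : Ckv 2 O X) (Cv : Ckv 1 O v) (Cw : Ckv 1 O w) (Cl : Ckv 1 O l)
  (Ca : Ck 1 O a).
Hypothesis frame : forall u, U u ->
  [/\ mink (nS u) (nS u) = 1, mink (nT u) (nT u) = -1,
      mink (nT u) (nS u) = 0 &
      forall i, mink (nT u) (partial i X u) = 0 /\
                mink (nS u) (partial i X u) = 0].
Hypothesis velocity : forall u, U u -> v u = a u *: l u.
Hypothesis acceleration : forall u, U u -> exists b, w u = b *: l u.

Let CXi i : Ckv 1 O (partial i X). Proof. exact: Ckv_derive. Qed.

(** A product that vanishes on the domain has vanishing derivatives there,
    boundary points included. *)
Lemma partial_mink_eq0 (f g : R * R -> 'rV[R]_4) i u :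
  Ckv 1 O f -> Ckv 1 O g -> (forall u, U u -> mink (f u) (g u) = 0) -> U u ->
  mink (partial i f u) (g u) = - mink (f u) (partial i g u).
Proof.
move=> Cf Cg fg Uu; apply/eqP; rewrite -addr_eq0; apply/eqP.
rewrite -(derive_mink (coord_dir R i) Cf Cg (UO Uu)).
rewrite (derive_eq_on_closure _ UO Ucl (Ck_mink oO Cf Cg) (Ck_cst 1 O 0)) //.
exact: derive_cst.
Qed.

Lemma lightlike u : U u -> mink (l u) (l u) = 0.
Proof.
move=> /frame[ss tt ts _].
by rewrite /l !minkDl !minkDr ss tt ts (minkC (nS u)) ts; ring.
Qed.

Lemma lightlike_normal i u : U u -> mink (l u) (partial i X u) = 0.
Proof. by move=> /frame[_ _ _ /(_ i)[t s]]; rewrite /l minkDl t s addr0. Qed.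

Lemma partial_lightlike i u : U u -> mink (partial i l u) (l u) = 0.
Proof.
move=> Uu; have := partial_mink_eq0 i Cl Cl lightlike Uu.
by rewrite (minkC (l u)) => /eqP; rewrite -addr_eq0 -mulr2n mulrn_eq0 => /eqP.
Qed.

(** The second fundamental form along [l], in the form in which the shape
    operator produces it; see [mink_normal_partial2]. *)
Definition lightlike_form u : 'M[R]_2 :=
  - \matrix_(i, j) mink (partial i l u) (partial j X u).

Lemma lightlike_formE i j u :
  mink (partial i l u) (partial j X u) = - lightlike_form u i j.
Proof. by rewrite !mxE opprK. Qed.

Lemma mink_normal_partial2 i j u : U u ->
  mink (l u) (partial i (partial j X) u) = lightlike_form u i j.
Proof.
move=> Uu; have := partial_mink_eq0 i Cl (CXi j) (lightlike_normal j) Uu.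
by rewrite lightlike_formE => /oppr_inj.
Qed.

Lemma lightlike_form_sym i j u : U u ->
  lightlike_form u i j = lightlike_form u j i.
Proof.
move=> Uu; rewrite -(mink_normal_partial2 i j Uu) -(mink_normal_partial2 j i Uu).
have E := Ckv_derive_commute (coord_dir R j) (coord_dir R i) oO CX (UO Uu).
exact: (congr1 (mink (l u)) E).
Qed.

Lemma partial_velocity i u : U u ->
  partial i v u = partial i a u *: l u + a u *: partial i l u.
Proof.
move=> Uu; rewrite /partial -(Ckv_deriveZ _ oO Ca Cl (UO Uu)).
exact: (Ckv_derive_eq_on_closure _ UO Ucl Cv (CkvZ oO Ca Cl)).
Qed.

Lemma mink_partial_velocity i j u : U u ->
  mink (partial i v u) (partial j X u) = - (a u * lightlike_form u i j).
Proof.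
move=> Uu; rewrite partial_velocity // minkDl !minkZl lightlike_normal //.
by rewrite lightlike_formE; ring.
Qed.

Lemma mink_partial_velocity2 i j u : U u ->
  mink (partial i v u) (partial j v u) =
  a u ^+ 2 * mink (partial i l u) (partial j l u).
Proof.
move=> Uu; rewrite (partial_velocity i Uu) (partial_velocity j Uu).
move: (lightlike Uu) (partial_lightlike i Uu) (partial_lightlike j Uu).
move: (partial i l u) (partial j l u) (partial i a u) (partial j a u) (l u).
move=> li lj ai aj lu n ni nj.
by rewrite !minkDl !minkDr !(minkZl, minkZr) n ni (minkC lu) nj; ring.
Qed.

(** The factor of the acceleration is an arbitrary function of the point, so
    [w = b l] cannot be differentiated; the identity [mink w X_j = 0] can. *)
Lemma mink_partial_acceleration b u : U u -> w u = b *: l u ->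
  forall i j, mink (partial i w u) (partial j X u) = - (b * lightlike_form u i j).
Proof.
move=> Uu wb i j.
have wn u' : U u' -> mink (w u') (partial j X u') = 0.
  move=> Uu'; have [c ->] := acceleration Uu'.
  by rewrite minkZl lightlike_normal // mulr0.
rewrite (partial_mink_eq0 i Cw (CXi j) wn Uu) wb minkZl.
by rewrite mink_normal_partial2.
Qed.

Lemma metric_det_second_variation u (g1 g2 : 'M[R]_2) :
  U u -> first_form X u \in unitmx -> \tr (shape_mx X l u) = 0 ->
  (forall i j, g1 i j = mink (partial i v u) (partial j X u) +
                        mink (partial i X u) (partial j v u)) ->
  (forall i j, g2 i j = mink (partial i w u) (partial j X u) +
                        2 * mink (partial i v u) (partial j v u) +
                        mink (partial i X u) (partial j w u)) ->
  let g := first_form X u in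
  g1 0 0 * g 1 1 + g 0 0 * g1 1 1 - 2 * (g 0 1 * g1 0 1) = 0 /\
  g2 0 0 * g 1 1 + 2 * (g1 0 0 * g1 1 1) + g 0 0 * g2 1 1
    - 2 * (g1 0 1 * g1 0 1) - 2 * (g 0 1 * g2 0 1) =
  4 * (a u ^+ 2 * \det (shape_mx X l u) * (g 0 0 * g 1 1 - g 0 1 * g 0 1)).
Proof.
move=> Uu gu tr g1E g2E g; have [b wb] := acceleration Uu.
have hE : lightlike_form u = shape_mx X l u *m g.
  by rewrite (shape_mx_second_form l gu).
apply: (@metric_det_variation _ g g1 g2 _ (lightlike_form u) (a u) b) => //.
- by rewrite !mxE minkC.
- exact: lightlike_form_sym.
- apply/matrixP => i j; rewrite g1E (minkC (partial i X u)).
  rewrite (mink_partial_velocity i j Uu) (mink_partial_velocity j i Uu).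
  rewrite (lightlike_form_sym j i Uu) [RHS]mxE.
  by move: (lightlike_form u) => h; ring.
apply/matrixP => i j; rewrite g2E (minkC (partial i X u)).
rewrite (mink_partial_acceleration Uu wb i j).
rewrite (mink_partial_acceleration Uu wb j i) (lightlike_form_sym j i Uu).
rewrite (mink_partial_velocity2 i j Uu).
(* The tangential coordinates of [l_i] are minus the i-th row of [S]. *)
have -> : mink (partial i l u) (partial j l u) =
    (shape_mx X l u *m lightlike_form u) i j.
  have [ss tt ts TS] := frame Uu.
  rewrite (@mink_orthogonal_lightlike _ (fun k => partial k X u) (nT u) (nS u)) //;
    try by [move=> k; case: (TS k) | exact: partial_lightlike].
  rewrite mxE; apply: eq_bigr => k _.
  rewrite (shape_mx_row l gu i k) (lightlike_form_sym k j Uu).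
  rewrite (minkC (partial k X u)) (lightlike_formE j k u).
  by rewrite mulrN mulNr.
rewrite [RHS]mxE [X in _ = X + _]mxE [X in _ = _ + X]mxE.
by move: (shape_mx X l u) (lightlike_form u) => S h; ring.
Qed.

End lightlike_variation.

(** * The Gram determinant *)

Section gram_determinant.
Variables (R : realType) (V : normedModType R) (O : set V) (oO : open O).
Variable G : 'I_2 -> 'I_2 -> V -> R.
Hypothesis CG : forall i j, Ck 2 O (G i j).

Definition gram_det (x : V) := G 0 0 x * G 1 1 x - G 0 1 x * G 0 1 x.

Lemma Ck_gram_det : Ck 2 O gram_det.
Proof.
by apply: CkD => //; [exact: CkM | apply: CkN => //; exact: CkM].
Qed.

Lemma derive_gram_det v x : O x ->
  'D_v gram_det x =
  'D_v (G 0 0) x * G 1 1 x + G 0 0 x * 'D_v (G 1 1) x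
    - 2 * (G 0 1 x * 'D_v (G 0 1) x).
Proof.
move=> Ox; have d i j : derivable (G i j) x v by exact: (Ck_derivable v (CG i j) Ox).
refine (etrans (deriveB (derivableM (d 0 0) (d 1 1))
                        (derivableM (d 0 1) (d 0 1))) _).
refine (etrans (congr2 (fun a b => a - b) (deriveM (d 0 0) (d 1 1))
                  (deriveM (d 0 1) (d 0 1))) _).
move: ('D_v (G 0 0) x) ('D_v (G 0 1) x) ('D_v (G 1 1) x) => a b c.
by rewrite /GRing.scale /=; ring.
Qed.

Lemma derive2_gram_det v x : O x ->
  'D_v ('D_v gram_det) x =
  'D_v ('D_v (G 0 0)) x * G 1 1 x + 2 * ('D_v (G 0 0) x * 'D_v (G 1 1) x)
    + G 0 0 x * 'D_v ('D_v (G 1 1)) x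
    - 2 * ('D_v (G 0 1) x * 'D_v (G 0 1) x)
    - 2 * (G 0 1 x * 'D_v ('D_v (G 0 1)) x).
Proof.
move=> Ox.
refine (etrans (derive2B oO v Ox (CkM oO (CG 0 0) (CG 1 1))
                         (CkM oO (CG 0 1) (CG 0 1))) _).
refine (etrans (congr2 (fun a b => a - b) (derive2M oO v Ox (CG 0 0) (CG 1 1))
                  (derive2M oO v Ox (CG 0 1) (CG 0 1))) _).
move: ('D_v ('D_v (G 0 0)) x) ('D_v ('D_v (G 0 1)) x) ('D_v ('D_v (G 1 1)) x).
move: ('D_v (G 0 0) x) ('D_v (G 0 1) x) ('D_v (G 1 1) x) => a b c a' b' c'.
by ring.
Qed.

End gram_determinant.

Lemma pos_def_gram (R : realType) (g : 'M[R]_2) :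
  pos_def g -> g 1 0 = g 0 1 -> 0 < g 0 0 * g 1 1 - g 0 1 * g 0 1.
Proof.
move=> pg gs.
have q (x y : R) : \row_(j < 2) (if j == 0 then x else y) != 0 ->
    0 < x * x * g 0 0 + 2 * (x * y) * g 0 1 + y * y * g 1 1.
  set w := \row_j _ => /pg.
  have mul2 (A : 'rV[R]_2) (B : 'cV[R]_2) : (A *m B) 0 0 = A 0 0 * B 0 0 + A 0 1 * B 1 0.
    by rewrite mxE big_ord_recl big_ord1 (_ : lift _ _ = 1) //; exact/val_inj.
  have mulg j : (w *m g) 0 j = x * g 0 j + y * g 1 j.
    rewrite mxE big_ord_recl big_ord1 (_ : lift _ _ = 1) ?mxE //=.
    exact/val_inj.
  rewrite mul2 !mulg gs !mxE /=.
  by congr (_ < _); ring.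
have g00 : 0 < g 0 0.
  have := q 1 0; rewrite !(mul1r, mulr0, mul0r, addr0); apply.
  by apply/eqP => /rowP /(_ 0); rewrite !mxE => /eqP; rewrite oner_eq0.
(* The vector [(- g01, g00)] has square [g00] times the determinant. *)
have : 0 < g 0 0 * (g 0 0 * g 1 1 - g 0 1 * g 0 1).
  have := q (- g 0 1) (g 0 0).
  have -> : - g 0 1 * - g 0 1 * g 0 0 + 2 * (- g 0 1 * g 0 0) * g 0 1 +
    g 0 0 * g 0 0 * g 1 1 = g 0 0 * (g 0 0 * g 1 1 - g 0 1 * g 0 1) by ring.
  apply; apply/eqP => /rowP /(_ 1); rewrite !mxE /= => /eqP.
  by rewrite gt_eqF.
by rewrite pmulr_rgt0.
Qed.

(** * The second variation of area *)

Section area_variation.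
Variables (R : realType) (U O : set (R * R)) (d : R).
Variables (X nT nS : R * R -> 'rV[R]_4) (alpha : R * R -> R).
Variable Xe : R -> R * R -> 'rV[R]_4.
Hypotheses (cU : compact U) (Ucl : U = closure U°) (oO : open O) (UO : U `<=` O).
Hypothesis d0 : 0 < d.
Let P : set (R * (R * R)) := [set e : R | `|e| < d] `*` O.
Let Y (p : R * (R * R)) := Xe p.1 p.2.
Hypotheses (CY : forall n, Ckv n P Y) (CX : Ckv 2 O X)
  (Cl : Ckv 1 O (fun u => nT u + nS u)) (Ca : Ck 1 O alpha).
Hypothesis metric_pos : forall e u, `|e| < d -> U u -> pos_def (first_form (Xe e) u).
Hypothesis Xe0 : forall u, U u -> Xe 0 u = X u.
Hypothesis frame : forall u, U u ->
  [/\ mink (nS u) (nS u) = 1, mink (nT u) (nT u) = -1,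
      mink (nT u) (nS u) = 0 &
      forall i, mink (nT u) (partial i X u) = 0 /\
                mink (nS u) (partial i X u) = 0].
Hypothesis mean_curvature0 :
  forall u, U u -> lightcone_mean_curvature X nT nS u = 0.
Hypothesis velocity : forall u, U u ->
  derive1 (fun e => Xe e u) 0 = alpha u *: (nT u + nS u).
Hypothesis acceleration : acceleration_along U Xe (fun u => nT u + nS u).

Let space i p := 'D_(0, coord_dir R i) Y p.
Let time : R * (R * R) := (1, 0).
Let G i j p := mink (space i p) (space j p).
Let q := gram_det G.

Lemma open_time_space : open P.
Proof.
rewrite openE => -[e u] [/= ed Ou].
have ne : \forall t \near e, `|t| < d.
  have : {for e, continuous (fun t : R => `|t|)} by exact: norm_continuous.
  by move/cvgr_lt => /(_ _ ed).
have nu : \forall y \near u, O y by exact: open_nbhs_nbhs.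
by exists ([set t : R | `|t| < d], O).
Qed.

Let oP := open_time_space.

Lemma Ckv_space n i : Ckv n P (space i).
Proof. exact: Ckv_derive. Qed.

Lemma Ck_metric i j : Ck 2 P (G i j).
Proof. by apply: Ck_mink => //; exact: Ckv_space. Qed.

Lemma partial_slice i e u : partial i (Xe e) u = space i (e, u).
Proof. exact: derive_slice_r. Qed.

Lemma first_form_slice e u i j : first_form (Xe e) u i j = G i j (e, u).
Proof. by rewrite mxE !partial_slice. Qed.

Lemma area_density_slice e u : area_density (Xe e) u = Num.sqrt (q (e, u)).
Proof. by rewrite /area_density !first_form_slice expr2. Qed.

Lemma time_space e u : `|e| < d -> U u -> P (e, u).
Proof. by move=> ed Uu; split=> //; exact: UO. Qed.

Lemma gram_gt0 e u : `|e| < d -> U u -> 0 < q (e, u).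
Proof.
move=> ed Uu; rewrite /q /gram_det -!first_form_slice; apply: pos_def_gram.
  exact: metric_pos.
by rewrite !mxE minkC.
Qed.

(* Positivity of [q] over the domain persists on an open set, on which the
   density is differentiable. *)
Let Q := P `&` [set p | 0 < q p].

Lemma open_gram_pos : open Q.
Proof.
rewrite openE => p [Pp qp].
have cq : {for p, continuous q}.
  exact: (Ck_continuous (Ck_gram_det oP Ck_metric) Pp).
have nP : \near p, P p by exact: open_nbhs_nbhs.
have nq : \forall p' \near p, 0 < q p' by move/cvgr_gt: cq => /(_ _ qp).
by apply: filterS (filterI nP nq) => p' [].
Qed.

Let rho p := Num.sqrt (q p).

Lemma Ck_rho : Ck 2 Q rho.
Proof.
apply: (Ck_sqrt open_gram_pos) => [p []//|].
by apply: Ck_subset (Ck_gram_det oP Ck_metric) => p [].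
Qed.

Lemma mem_gram_pos e u : `|e| < d -> U u -> Q (e, u).
Proof. by move=> ed Uu; split; [exact: time_space | exact: gram_gt0]. Qed.

Lemma norm0_lt : `|0 : R| < d. Proof. by rewrite normr0. Qed.

(** [Xe 0] and [X] are equal on the domain, but perhaps not around its boundary
    points. *)
Lemma partial_surface i u : U u -> partial i X u = partial i (Xe 0) u.
Proof.
move=> Uu; have CX0 : Ckv 1 O (Xe 0).
  apply: (@Ckv_subset _ _ _ 1 [set u | P (0, u)]).
    by move=> u' Ou'; split=> //; exact: norm0_lt.
  exact: (Ckv_slice_r 0 (CY 1)).
apply: (Ckv_derive_eq_on_closure _ UO Ucl (CkvS CX) CX0) => // u' Uu'.
by rewrite Xe0.
Qed.

Lemma first_form_surface u : U u -> first_form X u = first_form (Xe 0) u.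
Proof. by move=> Uu; apply/matrixP => i j; rewrite !mxE !partial_surface. Qed.

(** The time derivatives of the metric at time zero are read off from the
    velocity [v] and the acceleration [w] by commuting time and space
    derivatives. *)
Lemma derive2_gram_det_lightlike u : U u ->
  'D_time q (0, u) = 0 /\
  'D_time ('D_time q) (0, u) =
  4 * (alpha u ^+ 2 * lightcone_GK_curvature X nT nS u * q (0, u)).
Proof.
move=> Uu; have P0 := time_space norm0_lt Uu.
have sub0 : O `<=` [set u | P (0, u)].
  by move=> u' Ou'; split=> //; exact: norm0_lt.
pose v u := 'D_time Y (0, u); pose w u := 'D_time ('D_time Y) (0, u).
have Cv : Ckv 1 O v.
  apply: Ckv_subset sub0 _.
  exact: (Ckv_slice_r 0 (Ckv_derive time oP (CY 2))).
have Cw : Ckv 1 O w.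
  apply: Ckv_subset sub0 _.
  exact: (Ckv_slice_r 0 (Ckv_derive time oP (Ckv_derive time oP (CY 3)))).
have vE u' : U u' -> v u' = alpha u' *: (nT u' + nS u').
  move=> Uu'; rewrite -velocity // derive1E.
  exact: esym (derive_slice_l Y 0 u').
have wE u' : U u' -> exists b, w u' = b *: (nT u' + nS u').
  move=> /acceleration[b bE]; exists b; rewrite -bE derive1nS derive1n1 derive1E.
  have -> : derive1 (fun e => Xe e u') = (fun e => 'D_time Y (e, u')).
    by apply/funext => e; rewrite derive1E; exact: (derive_slice_l Y e u').
  exact: esym (derive_slice_l ('D_time Y) 0 u').
have vi i : partial i v u = 'D_time (space i) (0, u).
  refine (etrans (derive_slice_r ('D_time Y) 0 u (coord_dir R i)) _).
  exact: (Ckv_derive_commute time ((0 : R), coord_dir R i) oP (CY 2) P0).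
have wi i : partial i w u = 'D_time ('D_time (space i)) (0, u).
  refine (etrans (derive_slice_r ('D_time ('D_time Y)) 0 u (coord_dir R i)) _).
  refine (etrans (Ckv_derive_commute time ((0 : R), coord_dir R i) oP
    (Ckv_derive time oP (CY 3)) P0) _).
  apply: near_eq_derive.
  have nP : \forall p \near ((0 : R), u), P p by exact: open_nbhs_nbhs.
  near=> p.
  apply: (Ckv_derive_commute time ((0 : R), coord_dir R i) oP (CY 2)).
  by near: p; exact: nP.
have gE : first_form X u = \matrix_(i, j) G i j (0, u).
  rewrite (first_form_surface Uu); apply/matrixP => i j.
  by refine (etrans (first_form_slice 0 u i j) _); rewrite [RHS]mxE.
have Xi i : partial i X u = space i (0, u).
  by rewrite (partial_surface i Uu) partial_slice.
have gu : first_form X u \in unitmx.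
  have G10 : G 1 0 (0, u) = G 0 1 (0, u) by exact: minkC.
  rewrite unitmxE det_mx22 unitfE gE !mxE G10.
  exact: lt0r_neq0 (gram_gt0 norm0_lt Uu).
have tr : \tr (shape_mx X (fun u => nT u + nS u) u) = 0.
  have /eqP := mean_curvature0 Uu.
  by rewrite mulf_eq0 invr_eq0 pnatr_eq0 => /eqP.
have g1E i j : (\matrix_(i, j) 'D_time (G i j) (0, u)) i j =
    mink (partial i v u) (partial j X u) + mink (partial i X u) (partial j v u).
  rewrite mxE !vi !Xi.
  exact: (derive_mink time (Ckv_space 1 i) (Ckv_space 1 j) P0).
have g2E i j : (\matrix_(i, j) 'D_time ('D_time (G i j)) (0, u)) i j =
    mink (partial i w u) (partial j X u)
    + 2 * mink (partial i v u) (partial j v u)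
    + mink (partial i X u) (partial j w u).
  rewrite mxE !vi !wi !Xi.
  exact: (derive2_mink oP time P0 (Ckv_space 2 i) (Ckv_space 2 j)).
have [] := metric_det_second_variation oO UO Ucl CX Cv Cw Cl Ca frame vE wE
  Uu gu tr g1E g2E.
rewrite gE !mxE => D1 D2; split.
  exact: etrans (derive_gram_det Ck_metric time P0) D1.
exact: etrans (derive2_gram_det oP Ck_metric time P0) D2.
Unshelve. all: by end_near. Qed.

Lemma derive2_area_density u : U u ->
  'D_time ('D_time rho) (0, u) =
  2 * (alpha u ^+ 2 * lightcone_GK_curvature X nT nS u * area_density X u).
Proof.
move=> Uu; have [D1 D2] := derive2_gram_det_lightlike Uu.
have q0 := gram_gt0 norm0_lt Uu.
have -> : area_density X u = Num.sqrt (q (0, u)).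
  by rewrite -area_density_slice /area_density first_form_surface.
have Cq : Ck 2 Q q by apply: Ck_subset (Ck_gram_det oP Ck_metric) => p [].
have Qpos p : Q p -> 0 < q p by case.
refine (etrans (derive2_sqrt open_gram_pos (mem_gram_pos norm0_lt Uu) Qpos Cq D1) _).
rewrite D2 -{1}(sqr_sqrtr (ltW q0)).
have s0 : Num.sqrt (q (0, u)) != 0 by rewrite sqrtr_eq0 -ltNge.
move: (Num.sqrt _) s0 (lightcone_GK_curvature _ _ _ _) => s s0 K.
by field.
Qed.

Lemma second_variation_area :
  has_second_derivative_at0 (fun e => area U (Xe e))
    (2 * surface_integral U X
       (fun u => alpha u ^+ 2 * lightcone_GK_curvature X nT nS u)).
Proof.
pose mu := (@lebesgue_measure R \x @lebesgue_measure R)%E.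
have CQ := Ck_continuous Ck_rho.
have CQ1 := Ck_continuous (Ck_derive time Ck_rho).
have CQ2 := Ck_continuous (Ck_derive time (Ck_derive time Ck_rho)).
have areaE : (fun e => area U (Xe e)) =
    (fun e => Rintegral mu U (fun u => rho (e, u))).
  apply/funext => e; apply: eq_Rintegral => u _.
  by rewrite mul1r area_density_slice.
have D1 (e : R) : `|e| < d -> is_derive e 1 (fun e => area U (Xe e))
    (Rintegral mu U (fun u => 'D_time rho (e, u))).
  rewrite areaE => ed.
  apply: (@is_derive_integral_compact R U d rho ('D_time rho) cU _ e ed).
  move=> t u td Uu.
  have Qp := mem_gram_pos td Uu; split; [exact: CQ | exact: CQ1 |].
  exact: (is_derive_slice_l (Ck_is_derive time Ck_rho Qp)).
have D2 (e : R) : `|e| < d ->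
    is_derive e 1 (fun e => Rintegral mu U (fun u => 'D_time rho (e, u)))
      (Rintegral mu U (fun u => 'D_time ('D_time rho) (e, u))).
  move=> ed; apply: (@is_derive_integral_compact R U d ('D_time rho)
    ('D_time ('D_time rho)) cU _ e ed) => t u td Uu.
  have Qp := mem_gram_pos td Uu; split; [exact: CQ1 | exact: CQ2 |].
  exact: (is_derive_slice_l (Ck_is_derive time (Ck_derive time Ck_rho) Qp)).
have near0 : \forall e \near (0 : R), `|e| < d.
  have : {for (0 : R), continuous (fun t : R => `|t|)} by exact: norm_continuous.
  by move/cvgr_lt => /(_ _ norm0_lt).
split; first by near=> e; case: (D1 e) => //; near: e; exact: near0.
apply: (@near_eq_is_derive _ _ _
  (fun e => Rintegral mu U (fun u => 'D_time rho (e, u)))).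
  near=> e; have ed : `|e| < d by near: e; exact: near0.
  by have [_ De] := D1 e ed; rewrite derive1E De.
suff <- : Rintegral mu U (fun u => 'D_time ('D_time rho) (0, u)) =
    2 * surface_integral U X
       (fun u => alpha u ^+ 2 * lightcone_GK_curvature X nT nS u).
  exact: (D2 0 norm0_lt).
(* [alpha ^ 2 K] times the density is given the continuous representative
   [rho'' / 2], which is integrable. *)
have -> : surface_integral U X
      (fun u => alpha u ^+ 2 * lightcone_GK_curvature X nT nS u) =
    Rintegral mu U (fun u => 2^-1 * 'D_time ('D_time rho) (0, u)).
  apply: eq_Rintegral => u; rewrite inE => Uu.
  by rewrite (derive2_area_density Uu) mulKf // pnatr_eq0.
rewrite RintegralZl ?mulrA ?divff ?mul1r ?pnatr_eq0 //.
  exact: compact_measurable_plane.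
apply: continuous_integrable_plane => // u Uu.
apply: (@continuous_comp _ _ _ (pair 0) ('D_time ('D_time rho))).
  exact: continuous_pair.
exact: (CQ2 _ (mem_gram_pos norm0_lt Uu)).
Unshelve. all: by end_near. Qed.

End area_variation.

Theorem theorem5p2 (R : realType) (U : set (R * R))
    (X nT nS : R * R -> 'rV[R]_4) (alpha : R * R -> R)
    (Xe : R -> R * R -> 'rV[R]_4) :
  compact_domain U ->
  spacelike_embedding U X ->
  normal_frame U X nT nS ->
  smooth_near U alpha ->
  smooth_variation U X Xe ->
  ((forall u, U u -> lightcone_mean_curvature X nT nS u = 0) ->
   (forall u, U u ->
      derive1 (fun e => Xe e u) 0 = alpha u *: (nT u + nS u)) ->
   acceleration_along U Xe (fun u => nT u + nS u) ->
   has_second_derivative_at0 (fun e => area U (Xe e))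
     (2 * surface_integral U X
        (fun u => alpha u ^+ 2 * lightcone_GK_curvature X nT nS u)))
  /\
  ((forall u, U u ->
      lightcone_mean_curvature X nT (fun u' => - nS u') u = 0) ->
   (forall u, U u ->
      derive1 (fun e => Xe e u) 0 = alpha u *: (nT u - nS u)) ->
   acceleration_along U Xe (fun u => nT u - nS u) ->
   has_second_derivative_at0 (fun e => area U (Xe e))
     (2 * surface_integral U X
        (fun u => alpha u ^+ 2 *
           lightcone_GK_curvature X nT (fun u' => - nS u') u))).
Proof.
move=> [cU _ _ Ucl] [[[OX [oX UX sX]] _ _] _].
move=> [[OT [oT UT sT]] [OS [oS US sS]] frame] [Oa [oa Ua sa]].
move=> [d [d0 [OY [oY UY sY]] embed Xe0]].
pose O := OX `&` OT `&` OS `&` Oa `&` OY.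
have oO : open O by do !apply: openI.
have UO : U `<=` O.
  move=> u Uu; do !split; [exact: UX | exact: UT | exact: US | exact: Ua |].
  exact: UY.
have CX : Ckv 2 O X.
  by apply: Ckv_subset (smooth_on_Ckv 2 oX sX) => u [[[[]]]].
have CT : Ckv 1 O nT.
  by apply: Ckv_subset (smooth_on_Ckv 1 oT sT) => u [[[[]]]].
have CS : Ckv 1 O nS.
  by apply: Ckv_subset (smooth_on_Ckv 1 oS sS) => u [[[]]].
have Ca : Ck 1 O alpha.
  by apply: Ck_subset (smooth_on_Ck 1 sa) => u [[]].
have oP : open ([set e : R | `|e| < d] `*` OY) by exact: open_time_space.
have CY n : Ckv n ([set e : R | `|e| < d] `*` O)
    (fun p : R * (R * R) => Xe p.1 p.2).
  apply: Ckv_subset (smooth_on_Ckv n oP sY).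
  by move=> [e u] [ed [_ OYu]].
have metric e u : `|e| < d -> U u -> pos_def (first_form (Xe e) u).
  by move=> ed Uu; have [_] := embed e ed; exact.
split => [H velocity acceleration|H velocity acceleration].
  exact: (second_variation_area cU Ucl oO UO d0 CY CX (CkvD oO CT CS) Ca
    metric Xe0 frame H velocity acceleration).
apply: (second_variation_area cU Ucl oO UO d0 CY CX
  (CkvD oO CT (CkvN oO CS)) Ca metric Xe0 _ H velocity acceleration) => u Uu.
have [ss tt ts normal] := frame u Uu.
split=> [| || i]; rewrite ?minkNl ?minkNr ?opprK ?ts ?oppr0 //.
by have [tX nX] := normal i; rewrite nX oppr0.
Qed.
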